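(* Let $r\ge 3$, $s\ge 1$ be positive integers and let $\mathcal{H}$ be an $r$-uniform Berge-triangle-free hypergraph on $n$ vertices with matching number $\nu(\mathcal{H})=s$. If $r\in\{3,4\}$, then $$e(\mathcal{H})\le e(\mathcal{H}_r(s,n)).$$ In particular, when $r=3$, or when $r=4$, $n$ is even and $s>2$, the hypergraph $\mathcal{H}_r(s,n)$ is (up to isomorphism) the unique extremal hypergraph attaining equality.
   Context: An $r$-uniform hypergraph ($r$-graph) $\mathcal{H}$ consists of a finite vertex set $V(\mathcal{H})$ and an edge set $E(\mathcal{H})\subseteq\binom{V(\mathcal{H})}{r}$; $e(\mathcal{H})=|E(\mathcal{H})|$. The matching number $\nu(\mathcal{H})$ is the maximum number of pairwise disjoint edges of $\mathcal{H}$. A Berge-$K_3$ (Berge triangle) consists of three distinct edges $e_1,e_2,e_3$ for which there are three distinct vertices $x,y,z$ with $\{x,y\}\subseteq e_1$, $\{y,z\}\subseteq e_2$, $\{x,z\}\subseteq e_3$; $\mathcal{H}$ is Berge-triangle-free if it contains no such three edges. For $n\ge rs$ (automatic when $\nu(\mathcal{H})=s$) and $r\in\{3,4\}$, the $r$-graph $\mathcal{H}_r(s,n)$ on $n$ vertices is defined as follows; write $[m]=\{1,\dots,m\}$ and $[a,b]=\{a,a+1,\dots,b\}$ (empty if $b<a$). Case $r=3$: vertices $v_1,\dots,v_{2s},u_1,\dots,u_{n-2s}$ and edges $\{v_{2i-1},v_{2i},u_j\}$ for $i\in[s]$, $j\in[n-2s]$. Case $r=4$, $s=1$: write $n=4k+l+1$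 with $k,l$ nonnegative integers, $0\le l<4$. The vertices are $a_1,b_1,\dots,b_{4k+l}$. The edges are $\{a_1,b_{4i+1},b_{4i+2},b_{4i+3}\}$ and $\{a_1,b_{4i+2},b_{4i+3},b_{4i+4}\}$ for $i\in[0,k-1]$, together with, if $4\mid n$, the additional edge $\{a_1,b_{4k+1},b_{4k+2},b_{4k+3}\}$. Case $r=4$, $s\ge2$: vertices $v_1,\dots,v_{2s},u_1,\dots,u_{n-2s}$ and edges $\{v_{2i-1},v_{2i},u_{2j-1},u_{2j}\}$ for $i\in[s]$, $j\in\left[\left\lfloor\frac{n-2s}{2}\right\rfloor\right]$. *)

(* Defs.v *)
From mathcomp Require Import all_boot.

Set Implicit Arguments.
Unset Strict Implicit.
Unset Printing Implicit Defensive.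

(* A hypergraph is its edge set E : {set {set V}} over a vertex type V. *)

Definition uniform (V : finType) (r : nat) (E : {set {set V}}) : Prop :=
  forall e : {set V}, e \in E -> #|e| = r.

Definition matching_number (V : finType) (E : {set {set V}}) : nat :=
  \max_(M : {set {set V}} | (M \subset E) && trivIset M) #|M|.

Definition has_berge_triangle (V : finType) (E : {set {set V}}) : Prop :=
  exists e1 e2 e3 : {set V}, exists x y z : V,
    [/\ [/\ e1 \in E, e2 \in E & e3 \in E],
        [/\ e1 != e2, e2 != e3 & e1 != e3],
        [/\ x != y, y != z & x != z] &
        [/\ [set x; y] \subset e1, [set y; z] \subset e2
          & [set x; z] \subset e3]].

Definition berge_triangle_free (V : finType) (E : {set {set V}}) : Prop :=
  ~ has_berge_triangle E.

Definition isomorphic (V W : finType) (E : {set {set V}}) (F : {set {set W}})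
    : Prop :=
  exists f : V -> W, bijective f /\ F = [set f @: (e : {set V}) | e in E].

(* The subset of 'I_n with the listed elements (those >= n are dropped; none
   are in the constructions below when r * s <= n). *)
Definition vset (n : nat) (l : seq nat) : {set 'I_n} :=
  [set x : 'I_n | val x \in l].

(* v_1, ..., v_{2s} are 0, ..., 2s - 1 and u_1, ..., u_{n-2s} are
   2s, ..., n - 1; the indices i and j are shifted to start at 0. *)
Definition H3 (s n : nat) : {set {set 'I_n}} :=
  [set vset n [:: 2 * i; 2 * i + 1; 2 * s + j]
    | i : 'I_s, j : 'I_(n - 2 * s)].

(* a_1 is 0 and b_m is m; n = 4k + l + 1 with l < 4. *)
Definition H4_star (n : nat) : {set {set 'I_n}} :=
  let k := (n - 1) %/ 4 in
  [set vset n [:: 0; 4 * i + 1; 4 * i + 2; 4 * i + 3] | i : 'I_k]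
  :|: [set vset n [:: 0; 4 * i + 2; 4 * i + 3; 4 * i + 4] | i : 'I_k]
  :|: (if 4 %| n then [set vset n [:: 0; 4 * k + 1; 4 * k + 2; 4 * k + 3]]
       else set0).

(* Same vertex labelling as in H3. *)
Definition H4_grid (s n : nat) : {set {set 'I_n}} :=
  [set vset n [:: 2 * i; 2 * i + 1; 2 * s + 2 * j; 2 * s + 2 * j + 1]
    | i : 'I_s, j : 'I_((n - 2 * s) %/ 2)].

(* Only meaningful for r = 3 and r = 4. *)
Definition Hext (r s n : nat) : {set {set 'I_n}} :=
  if r == 3 then H3 s n
  else if r == 4 then (if s == 1 then H4_star n else H4_grid s n)
  else set0.

(* Main.v *)
(** In a Berge-triangle-free hypergraph, let e be an edge and c a vertex outside e.
    Then either a single edge joins c to e, or all edges joining c to e meet e in the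
    same single vertex.

    For r = 3, fix a maximum matching M.  Call (e, c), with e in M and c outside e, a
    slot, owned by the edge joining c to e when that edge is unique.  A slot has
    weight 3 if c is uncovered by M and 1 otherwise.  Every edge outside M owns slots
    of total weight at least 3, and comparing with the total weight of all slots gives
    the bound.  In the case of equality every slot is owned and every edge outside M
    owns exactly weight 3, which forces every such edge to consist of a fixed pair of
    some e in M and one more vertex.

    For r = 4, let every vertex c outside e, joined to e by d <= 2 edges, give 1/d to
    each of these edges.  An edge meeting e in at most two vertices receives at least
    2, so an edge e meets at most (n - 2) / 2 edges, itself included, or (n - 1) / 2
    if e lies in a diamond, i.e. a pair of edges with three common vertices.  Since
    s * ((n - 2s) / 2) drops by exactly n / 2 - 1 (quotients rounded down) when s drops
    by 1 and n by 4, one deletes the edges meeting one edge e of a maximum matching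
    and inducts on s.  When e meets (n - 1) / 2 edges, all vertices outside e are
    joined to e by diamonds; then few edges meet a second matching edge and avoid e,
    and the edges meeting either of the two are deleted at once.  In the case of
    equality (n even, s > 2) any two edges of the matching are met by exactly two
    common edges, each of which takes a pair from both. *)

Require Import Defs.
From mathcomp Require Import all_boot zify.

Set Implicit Arguments.
Unset Strict Implicit.
Unset Printing Implicit Defensive.

(** * Edges meeting a fixed edge *)

Lemma triangle_absurd (V : finType) (E : {set {set V}}) (e1 e2 e3 : {set V})
    (x y z : V) :
  berge_triangle_free E -> e1 \in E -> e2 \in E -> e3 \in E ->
  e1 != e2 -> e2 != e3 -> e1 != e3 -> x != y -> y != z -> x != z ->
  x \in e1 -> y \in e1 -> y \in e2 -> z \in e2 -> x \in e3 -> z \in e3 -> False.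
Proof.
move=> fr h1 h2 h3 n12 n23 n13 nxy nyz nxz x1 y1 y2 z2 x3 z3.
apply: fr; exists e1, e2, e3, x, y, z.
by split; split=> //; apply/subsetP=> w; rewrite !inE => /orP[] /eqP->.
Qed.

Lemma exists_neq (T : finType) (A : {set T}) (x : T) :
  1 < #|A| -> exists2 y, y \in A & y != x.
Proof.
move=> hA; have : 0 < #|A :\ x| by have := cardsD1 x A; lia.
by case/card_gt0P=> y; rewrite !inE => /andP[? ?]; exists y.
Qed.

Lemma exists_neq2 (T : finType) (A : {set T}) (x y : T) :
  2 < #|A| -> exists z, [/\ z \in A, z != x & z != y].
Proof.
move=> hA; have [|z] := @exists_neq _ (A :\ x) y.
  by have := cardsD1 x A; lia.
by rewrite !inE => /andP[? ?] ?; exists z.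
Qed.

Lemma card_meet_gt0 (T : finType) (A B : {set T}) :
  reflect (exists2 x, x \in A & x \in B) (~~ [disjoint A & B]).
Proof.
rewrite -setI_eq0; apply: (iffP (set0Pn _)) => [[x]|[x xA xB]].
  by rewrite inE => /andP[]; exists x.
by exists x; rewrite inE xA.
Qed.

(** A third vertex [z] of [A :&: B] closes a triangle with [f], [A] and [B] as soon as one of [x],
    [y] lies in [A] and the other in [B]. Otherwise both lie in [A :\: B] or both in [B :\: A],
    which are singletons. *)
Lemma diamond_meet (V : finType) (E : {set {set V}}) (A B f : {set V}) :
  uniform 4 E -> berge_triangle_free E -> A \in E -> B \in E -> f \in E ->
  #|A :&: B| = 3 -> f != A -> f != B -> #|f :&: (A :|: B)| <= 1.
Proof.
move=> un fr hA hB hf cAB fA fB; rewrite leqNgt; apply/negP=> /card_gt1P[x [y]].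
rewrite !inE => -[/andP[xf xAB] /andP[yf yAB] nxy].
have [|z [zAB zx zy]] := @exists_neq2 _ (A :&: B) x y; first by rewrite cAB.
move: zAB; rewrite inE => /andP[zA zB].
have nAB : A != B by apply: contra_eq_neq cAB => ->; rewrite setIid (un _ hB).
have cD : #|A :\: B| = 1 by move: (cardsID B A); rewrite cAB (un _ hA); clear; lia.
have cD' : #|B :\: A| = 1 by move: (cardsID A B); rewrite setIC cAB (un _ hB); clear; lia.
have K1 : ~ (x \in A /\ y \in B).
  case=> xA yB; apply: (@triangle_absurd _ E f B A x y z) => //; try by rewrite eq_sym.
have K2 : ~ (x \in B /\ y \in A).
  case=> xB yA; apply: (@triangle_absurd _ E f A B x y z) => //; try by rewrite eq_sym.
have [xA|xA] := boolP (x \in A).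
  have yB : y \notin B by apply/negP => yB; apply: K1.
  have yA : y \in A by move: yAB; rewrite (negPf yB) orbF.
  have xB : x \notin B by apply/negP => xB; apply: K2.
  move/eqP/cards1P: cD => [w hw].
  have: x \in A :\: B by rewrite inE xB.
  have: y \in A :\: B by rewrite inE yB.
  by rewrite hw !inE => /eqP e1 /eqP e2; rewrite e1 e2 eqxx in nxy.
have xB : x \in B by move: xAB; rewrite (negPf xA).
have yA : y \notin A by apply/negP => yA; apply: K2.
have yB : y \in B by move: yAB; rewrite (negPf yA).
move/eqP/cards1P: cD' => [w hw].
have: x \in B :\: A by rewrite inE xA.
have: y \in B :\: A by rewrite inE yA.
by rewrite hw !inE => /eqP e1 /eqP e2; rewrite e1 e2 eqxx in nxy.
Qed.

Lemma cards3P (T : finType) (A : {set T}) : #|A| = 3 ->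
  exists x y z, [/\ x != y, x != z, y != z & A = [set x; y; z]].
Proof.
move=> cA; have /card_gt0P[x xA] : 0 < #|A| by rewrite cA.
have c2 : #|A :\ x| = 2 by move: (cardsD1 x A); rewrite xA cA; clear; lia.
move/eqP/cards2P: (c2) => [y [z [yz e]]].
have yA : y \in A :\ x by rewrite e !inE eqxx.
have zA : z \in A :\ x by rewrite e !inE eqxx orbT.
move: yA zA; rewrite !inE => /andP[yx _] /andP[zx _].
exists x, y, z; split; rewrite // 1?eq_sym //.
by rewrite -(setD1K xA) e setUA.
Qed.

(** * Vertex contributions to the edges meeting an edge *)

Definition deg (V : finType) (Z : {set {set V}}) (c : V) : nat :=
  #|[set f in Z | c \in f]|.

(* Twice the contribution 1/d of a vertex of degree d <= 2. *)
Definition share (d : nat) : nat := (d == 1).*2 + (d == 2).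

Lemma mul_share_le d : d * share d <= 2.
Proof. by case: d => [|[|[|d]]] //=; rewrite muln0. Qed.

Lemma deg_gt0 (V : finType) (Z : {set {set V}}) f c :
  f \in Z -> c \in f -> 0 < deg Z c.
Proof. by move=> fZ cf; apply/card_gt0P; exists f; rewrite inE fZ. Qed.

Lemma deg_eq1 (V : finType) (Z : {set {set V}}) f c :
  f \in Z -> c \in f -> (forall g, g \in Z -> c \in g -> g = f) -> deg Z c = 1.
Proof.
move=> fZ cf h; apply/eqP/cards1P; exists f; apply/setP => g; rewrite !inE.
by apply/andP/eqP => [[/h h1 /h1]|->].
Qed.

Lemma deg_neq1 (V : finType) (Z : {set {set V}}) f c :
  f \in Z -> c \in f -> deg Z c != 1 -> exists g, [/\ g \in Z, c \in g & g != f].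
Proof.
move=> fZ cf h.
have [|g] := @exists_neq _ [set f in Z | c \in f] f.
  by move: (deg_gt0 fZ cf) h; rewrite /deg; lia.
by rewrite inE => /andP[gZ cg] ngf; exists g.
Qed.

Definition meeting (V : finType) (E : {set {set V}}) (e : {set V}) :=
  [set f in E | ~~ [disjoint f & e]].

(** If another edge [g] through [c] meets [e] in [x], some [y != x] in [f :&: e] makes [c], [y], [x]
    a triangle of [f], [e], [g]. *)
Lemma trace2_unique (V : finType) (E : {set {set V}}) (e f g : {set V}) c :
  berge_triangle_free E -> e \in E -> f \in E -> g \in meeting E e -> f != e ->
  1 < #|f :&: e| -> c \in f -> c \notin e -> c \in g -> g = f.
Proof.
move=> fr eE fE; rewrite inE => /andP[gE /card_meet_gt0[x xg xe]] nfe fe2 cf ce cg.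
apply/eqP/negPn/negP => ngf.
have [y] := @exists_neq _ _ x fe2; rewrite inE => /andP[yf ye] yx.
apply: (@triangle_absurd _ E f e g c y x) => //.
- by apply: contraNneq ce => ->.
- by rewrite eq_sym.
- by apply: contraNneq ce => ->.
- by apply: contraNneq ce => ->.
Qed.

(** Two edges through [c] that meet [e] in different vertices form a triangle with [e]. *)
Lemma trace_eq (V : finType) (E : {set {set V}}) (e f g : {set V}) c a x :
  berge_triangle_free E -> e \in E -> f \in E -> g \in E -> g != f ->
  c \in f -> c \in g -> c \notin e -> a \in f -> a \in e -> x \in g -> x \in e ->
  x = a.
Proof.
move=> fr eE fE gE ngf cf cg ce af ae xg xe; apply/eqP/negPn/negP => nxa.
apply: (@triangle_absurd _ E f e g c a x) => //.
- by apply: contraNneq ce => <-.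
- by apply: contraNneq ce => ->.
- by rewrite eq_sym.
- by apply: contraNneq ce => ->.
- by rewrite eq_sym.
- by apply: contraNneq ce => ->.
Qed.

(** By [trace_eq], all edges of [Z] through [c] or [d] pass through [a]. Two different edges other
    than [f], one through [c] and one through [d], would form a triangle with [f] on [c], [d], [a];
    hence they are one edge [g]. *)
Lemma heavy_pair (V : finType) (E Z : {set {set V}}) (e f : {set V}) (a c d : V) :
  berge_triangle_free E -> e \in E -> Z \subset meeting E e ->
  f \in Z -> a \in f -> a \in e -> c \in f -> d \in f -> c \notin e -> d \notin e ->
  c != d -> deg Z c != 1 -> deg Z d != 1 ->
  exists g, [/\ g \in Z, g != f, [/\ a \in g, c \in g & d \in g]
            & [set h in Z | c \in h] = [set f; g]].
Proof.
move=> fr eE /subsetP ZE fZ af ae cf df ce de cd hc hd.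
have ZE' h : h \in Z -> h \in E /\ exists2 x, x \in h & x \in e.
  by move=> /ZE; rewrite inE => /andP[? /card_meet_gt0].
have aP h k : h \in Z -> k \in f -> k \notin e -> k \in h -> h != f -> a \in h.
  move=> /ZE'[hE [x xh xe]] kf ke kh nhf.
  by rewrite -(@trace_eq _ E e f h k a x) //; case: (ZE' _ fZ).
have [g1 [g1Z dg1 ng1]] := deg_neq1 fZ df hd.
have key g2 : g2 \in Z -> c \in g2 -> g2 != f -> g2 = g1.
  move=> g2Z cg2 ng2; apply/eqP/negPn/negP => n12.
  apply: (@triangle_absurd _ E f g1 g2 c d a) => //; rewrite 1?eq_sym //.
  - by case: (ZE' _ fZ).
  - by case: (ZE' _ g1Z).
  - by case: (ZE' _ g2Z).
  - by apply: contraNneq de => <-.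
  - by apply: contraNneq ce => <-.
  - by apply: (aP _ d).
  - by apply: (aP _ c).
have [g2 [g2Z cg2 ng2]] := deg_neq1 fZ cf hc.
have e12 := key _ g2Z cg2 ng2.
exists g1; rewrite g1Z ng1 -{2}e12 cg2 dg1; split=> //; first by rewrite (aP _ d).
apply/setP => h; rewrite !inE; apply/andP/orP => [[hZ ch]|].
  by case: (eqVneq h f) => [|nhf]; [left | right; rewrite (key h)].
by case=> /eqP->; rewrite ?fZ ?cf // g1Z -e12.
Qed.

(** Shares are doubled, so 4 stands for a received total of 2. If [f] meets [e] in two vertices, its
    two outer vertices have degree 1 and give 2 each. If it meets [e] once, either two of the three
    outer vertices have degree 1, or two have degree 2 and the third degree 1, giving 1 + 1 + 2. *)
Lemma share_sum_ge4 (V : finType) (E Z : {set {set V}}) (e f : {set V}) :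
  uniform 4 E -> berge_triangle_free E -> e \in E ->
  Z \subset meeting E e -> f \in Z -> f != e -> #|f :&: e| <= 2 ->
  4 <= \sum_(c in f :\: e) share (deg Z c).
Proof.
move=> un fr eE ZE fZ nfe fe2.
have fE : f \in E by move/subsetP: ZE => /(_ f fZ); rewrite inE => /andP[].
have [a af ae] : exists2 a, a \in f & a \in e.
  by move/subsetP: ZE => /(_ f fZ); rewrite inE => /andP[_ /card_meet_gt0].
have cfe : #|f :&: e| + #|f :\: e| = 4 by rewrite cardsID un.
have [fe1|fe1] := leqP #|f :&: e| 1; last first.
  rewrite (eq_bigr (fun=> 2)) => [|c]; last first.
    rewrite inE => /andP[ce cf]; rewrite (@deg_eq1 _ _ f) // => g gZ cg.
    by apply: (@trace2_unique _ E e f g c) => //; apply: (subsetP ZE).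
  by rewrite sum_nat_const; move: fe2 fe1 cfe; clear; lia.
have c3 : #|f :\: e| = 3.
  have : 0 < #|f :&: e| by apply/card_gt0P; exists a; rewrite inE af.
  by move: fe1 cfe; clear; lia.
have fae : f :&: e = [set a].
  apply/eqP; rewrite eq_sym eqEcard cards1 fe1 andbT.
  by apply/subsetP => z; rewrite !inE => /eqP->; rewrite af.
have [x [y [z [xy xz yz def]]]] := cards3P c3.
have mem u : u \in [set x; y; z] -> u \in f /\ u \notin e.
  by rewrite -def inE => /andP[].
have [xf xe] : x \in f /\ x \notin e by apply: mem; rewrite !inE eqxx.
have [yf ye] : y \in f /\ y \notin e by apply: mem; rewrite !inE eqxx orbT.
have [zf ze] : z \in f /\ z \notin e by apply: mem; rewrite !inE eqxx orbT.
(* Outer vertices [c], [d] of degree other than 1 share their second edge [g]. Were [h] also of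
   degree other than 1, [g] would contain it too, together with [a], and so equal [f]. *)
have P c d h : c \in f -> c \notin e -> d \in f -> d \notin e ->
    h \in f -> h \notin e -> c != d -> c != h -> d != h ->
    [set c; d; h] = f :\: e ->
    deg Z c != 1 -> deg Z d != 1 -> 
    [/\ deg Z c = 2, deg Z d = 2 & deg Z h = 1].
  move=> cf ce df de hf he cd ch dh E3 hc hd.
  have [g [gZ ngf [ag cg dg] eqc]] := heavy_pair fr eE ZE fZ af ae cf df ce de cd hc hd.
  have [g' [_ _ _ eqd]] : exists g', [/\ g' \in Z, g' != f,
      [/\ a \in g', d \in g' & c \in g'] & [set h in Z | d \in h] = [set f; g']].
    by apply: (@heavy_pair _ E Z e f a d c) => //; rewrite eq_sym.
  have e2 : deg Z c = 2 by rewrite /deg eqc cards2; move: ngf; case: eqVneq => // ->; rewrite eqxx.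
  have e2' : deg Z d = 2.
    rewrite /deg eqd cards2; case: eqVneq => //= fg'.
    move/setP/(_ g): eqd; rewrite !inE gZ dg -fg' orbb /= => /esym/eqP gf.
    by rewrite gf eqxx in ngf.
  split=> //; apply/eqP/negPn/negP => nh.
  have [g1 [g1Z ng1 [_ _ hg1] eqc1]] := heavy_pair fr eE ZE fZ af ae cf hf ce he ch hc nh.
  have g1g : g1 = g.
    move/setP/(_ g1): eqc; rewrite eqc1 !inE eqxx orbT (negPf ng1) /=.
    by move/esym/eqP.
  have fg : f \subset g.
    rewrite -(setID f e) fae -E3; apply/subsetP=> u.
    by rewrite !inE -!orbA => /or4P[]/eqP-> //; rewrite -g1g.
  have gE : g \in E by move/subsetP: ZE => /(_ g gZ); rewrite inE => /andP[].
  have : f == g by rewrite eqEcard fg (un _ fE) (un _ gE).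
  by rewrite eq_sym (negPf ngf).
have S : \sum_(c in f :\: e) share (deg Z c)
   = share (deg Z x) + (share (deg Z y) + share (deg Z z)).
  rewrite def setUC setUA !(setUC [set z]).
  have -> : [set x] :|: [set z] :|: [set y] = x |: (y |: [set z]).
    by apply/setP => u; rewrite !inE; do 3!case: (u == _).
  rewrite big_setU1 ?inE ?negb_or ?xy ?xz //= big_setU1 ?inE ?yz //=.
  by rewrite big_set1.
rewrite S.
have [dx|dx] := eqVneq (deg Z x) 1; have [dy|dy] := eqVneq (deg Z y) 1.
- by rewrite dx dy.
- have [dz|dz] := eqVneq (deg Z z) 1.
    by rewrite dx dz; exact: (@leq_add 2 2 2 (share (deg Z y) + 2) isT (leq_addl _ 2)).
  have def' : [set y; z; x] = f :\: e.
    by rewrite def; apply/setP => u; rewrite !inE; do 3!case: (u == _).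
  rewrite eq_sym in xy; rewrite eq_sym in xz.
  by have [-> -> ->] := P y z x yf ye zf ze xf xe yz xy xz def' dy dz.
- have [dz|dz] := eqVneq (deg Z z) 1; first by rewrite dy dz; exact: (leq_addl _ 4).
  have def' : [set x; z; y] = f :\: e.
    by rewrite def; apply/setP => u; rewrite !inE; do 3!case: (u == _).
  rewrite eq_sym in yz.
  by have [-> -> ->] := P x z y xf xe zf ze yf ye xz xy yz def' dx dz.
by have [-> -> ->] := P x y z xf xe yf ye zf ze xy xz yz (esym def) dx dy.
Qed.

Lemma share_sum_exchange (V : finType) (Z : {set {set V}}) (e : {set V}) :
  \sum_(f in Z) \sum_(c in f :\: e) share (deg Z c)
  = \sum_(c in cover Z :\: e) deg Z c * share (deg Z c).
Proof.
rewrite (exchange_big_dep (mem (cover Z :\: e))) /=; last first.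
  move=> f c fZ; rewrite !inE => /andP[-> cf] /=.
  by apply/bigcupP; exists f.
apply: eq_bigr => c; rewrite inE => /andP[ce _].
rewrite sum_nat_cond_const; congr (_ * _); apply: eq_card => f.
by rewrite !inE ce.
Qed.

(** Every edge receives at least 4 and every covered vertex outside [e] gives at most 2 in all. *)
Lemma light_meeting_card (V : finType) (E Z : {set {set V}}) (e : {set V}) :
  uniform 4 E -> berge_triangle_free E -> e \in E -> Z \subset meeting E e ->
  (forall f, f \in Z -> f != e /\ #|f :&: e| <= 2) ->
  2 * #|Z| <= #|cover Z :\: e|.
Proof.
move=> un fr eE ZE Ze.
have lo : #|Z| * 4 <= \sum_(f in Z) \sum_(c in f :\: e) share (deg Z c).
  rewrite -sum_nat_const; apply: leq_sum => f fZ; have [? ?] := Ze f fZ.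
  exact: (@share_sum_ge4 _ E).
have hi : \sum_(c in cover Z :\: e) deg Z c * share (deg Z c) <= #|cover Z :\: e| * 2.
  by rewrite -sum_nat_const; apply: leq_sum => c _; apply: mul_share_le.
by move: lo hi; rewrite share_sum_exchange; clear; lia.
Qed.

(** Different traces [{x, y}] and [{x, z}] would make [y], [x], [z] a triangle of [f], [g], [e]. *)
Lemma trace_share (V : finType) (E : {set {set V}}) (e f g : {set V}) x :
  berge_triangle_free E -> e \in E -> f \in E -> g \in E -> f != e -> g != e ->
  #|f :&: e| = 2 -> #|g :&: e| = 2 -> x \in f -> x \in g -> x \in e ->
  f :&: e = g :&: e.
Proof.
move=> fr eE fE gE fe ge cf cg xf xg xe.
have [<-//|fg] := eqVneq f g.
have [y] : exists2 y, y \in f :&: e & y != x by apply: exists_neq; rewrite cf.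
rewrite inE => /andP[yf ye] yx.
have [z] : exists2 z, z \in g :&: e & z != x by apply: exists_neq; rewrite cg.
rewrite inE => /andP[zg ze] zx.
have two (h : {set V}) w : #|h :&: e| = 2 -> x \in h -> w \in h -> w \in e -> w != x ->
    h :&: e = [set x; w].
  move=> ch xh wh we wx; apply/esym/eqP; rewrite eqEcard ch cards2 eq_sym wx andbT.
  by apply/subsetP => v; rewrite !inE => /orP[]/eqP->; rewrite ?xh ?wh.
rewrite (two f y) // (two g z) //.
have [->//|yz] := eqVneq y z.
by case: (@triangle_absurd _ E f g e y x z) => //; rewrite eq_sym.
Qed.

Lemma sum_le_eq (T : finType) (A : {set T}) (F G : T -> nat) :
  (forall i, i \in A -> F i <= G i) -> \sum_(i in A) G i <= \sum_(i in A) F i ->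
  forall i, i \in A -> F i = G i.
Proof.
move=> FG; rewrite leqNgt => S i iA; apply/eqP; rewrite eqn_leq FG //=.
rewrite leqNgt; apply: contra S => lt.
rewrite (bigD1 i) //= [ltnRHS](bigD1 i) //= -addSn leq_add //.
by apply: leq_sum => j /andP[? _]; apply: FG.
Qed.

(** * Traces of size three, and the number of edges meeting an edge *)

Lemma card_trace_le3 (V : finType) (E : {set {set V}}) (e f : {set V}) :
  uniform 4 E -> e \in E -> f \in E -> f != e -> #|f :&: e| <= 3.
Proof.
move=> un eE fE; apply: contraR; rewrite -ltnNge => h.
by rewrite eqEcard un // un // leqnn andbT; apply/setIidPl/eqP;
  rewrite eqEcard subsetIl un.
Qed.

(** [e] and [f] form a diamond, and by [diamond_meet] a third edge meets their union at most
    once. *)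
Lemma trace3_unique (V : finType) (E : {set {set V}}) (e f g : {set V}) :
  uniform 4 E -> berge_triangle_free E -> e \in E -> f \in E -> g \in E ->
  #|f :&: e| = 3 -> #|g :&: e| = 3 -> g = f.
Proof.
move=> un fr eE fE gE fe ge; apply/eqP/negPn/negP => ngf.
have nge : g != e by apply: contra_eq_neq ge => ->; rewrite setIid un.
have := diamond_meet un fr eE fE gE _ nge ngf; rewrite setIC => /(_ fe).
apply/negP; rewrite -ltnNge; apply: leq_trans (_ : 2 <= #|g :&: e|) _.
  by rewrite ge.
by apply: subset_leq_card; apply: setIS; apply: subsetUl.
Qed.

Lemma meetingP (V : finType) (E : {set {set V}}) (e f : {set V}) :
  reflect (f \in E /\ exists2 x, x \in f & x \in e) (f \in meeting E e).
Proof.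
by rewrite inE; apply: (iffP andP) => [[? /card_meet_gt0]|[? /card_meet_gt0]].
Qed.

Lemma mem_meeting (V : finType) (E : {set {set V}}) (e : {set V}) :
  uniform 4 E -> e \in E -> e \in meeting E e.
Proof.
move=> un eE; apply/meetingP; split=> //.
have /card_gt0P[x xe] : 0 < #|e| by rewrite un.
by exists x.
Qed.

Lemma trace3_meeting (V : finType) (E : {set {set V}}) (e f : {set V}) :
  f \in E -> #|f :&: e| = 3 -> f \in meeting E e.
Proof.
move=> fE fe; apply/meetingP; split=> //.
have /card_gt0P[x] : 0 < #|f :&: e| by rewrite fe.
by rewrite inE => /andP[]; exists x.
Qed.

Lemma trace3_neq (V : finType) (E : {set {set V}}) (e f : {set V}) :
  uniform 4 E -> e \in E -> #|f :&: e| = 3 -> f != e.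
Proof. by move=> un eE; apply: contra_eq_neq => ->; rewrite setIid un. Qed.

Definition outer (V : finType) (E : {set {set V}}) (e : {set V}) : {set V} :=
  cover (meeting E e :\ e) :\: e.

Lemma outerP (V : finType) (E : {set {set V}}) (e : {set V}) c :
  reflect (c \notin e /\ exists f, [/\ f \in meeting E e, f != e & c \in f])
    (c \in outer E e).
Proof.
rewrite inE; apply: (iffP andP) => -[ce].
  case/bigcupP => f; rewrite in_setD1 => /andP[fe fm] cf; split=> //.
  by exists f.
by case=> f [fm fe cf]; split=> //; apply/bigcupP; exists f; rewrite // in_setD1 fe.
Qed.

Lemma meeting_card_light (V : finType) (E : {set {set V}}) (e : {set V}) :
  uniform 4 E -> berge_triangle_free E -> e \in E ->
  (forall f, f \in E -> #|f :&: e| != 3) ->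
  2 * #|meeting E e| <= #|outer E e| + 2.
Proof.
move=> un fr eE light; have em := mem_meeting un eE.
rewrite (cardsD1 e) em mulnDr addnC leq_add2r.
apply: (light_meeting_card un fr eE (subsetDl _ _)) => f.
rewrite in_setD1 => /andP[fe /meetingP[fE _]]; split=> //.
by move: (card_trace_le3 un eE fE fe) (light f fE); clear; lia.
Qed.

(** Meant for a diamond [e], [B]: the other edges meeting [e], each of which has just one vertex in
    [e :|: B]. *)
Definition heavy_rest (V : finType) (E : {set {set V}}) (e B : {set V}) :=
  meeting E e :\ e :\ B.

Lemma heavy_restP (V : finType) (E : {set {set V}}) (e B f : {set V}) :
  uniform 4 E -> berge_triangle_free E -> e \in E -> B \in E -> #|B :&: e| = 3 ->
  f \in heavy_rest E e B ->
  [/\ f \in E, f != e, f != B, #|f :&: (e :|: B)| <= 1 & exists2 x, x \in f & x \in e].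
Proof.
move=> un fr eE BE Be; rewrite !in_setD1 => /and3P[fB fe /meetingP[fE fx]].
by split=> //; apply: (diamond_meet un) => //; rewrite setIC.
Qed.

Lemma card_diamond (V : finType) (E : {set {set V}}) (e B : {set V}) :
  uniform 4 E -> e \in E -> B \in E -> #|B :&: e| = 3 -> #|e :|: B| = 5.
Proof.
move=> un eE BE Be; move: (cardsUI e B); rewrite (setIC e) Be (un e eE) (un B BE).
by clear; lia.
Qed.

Lemma card_heavy_rest (V : finType) (E : {set {set V}}) (e B : {set V}) :
  uniform 4 E -> e \in E -> B \in E -> #|B :&: e| = 3 ->
  #|meeting E e| = #|heavy_rest E e B| + 2.
Proof.
move=> un eE BE Be.
rewrite (cardsD1 e) mem_meeting // (cardsD1 B (_ :\ e)) !in_setD1.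
by rewrite (trace3_neq un eE Be) (trace3_meeting BE Be) addnA addnC.
Qed.

Lemma heavy_rest_card (V : finType) (E : {set {set V}}) (e B : {set V}) :
  uniform 4 E -> berge_triangle_free E -> e \in E -> B \in E -> #|B :&: e| = 3 ->
  2 * #|heavy_rest E e B| <= #|cover (heavy_rest E e B) :\: e|.
Proof.
move=> un fr eE BE Be.
apply: (light_meeting_card un fr eE) => [|f /(heavy_restP un fr eE BE Be)].
  by apply: subset_trans (subsetDl _ _) (subsetDl _ _).
case=> _ fe _ fD _; split=> //; apply: leq_trans (leqW fD).
by apply: subset_leq_card; apply: setIS; apply: subsetUl.
Qed.

(** A rest edge containing a vertex of [B] outside [e] would have two vertices in [e :|: B]. *)
Lemma cover_heavy_rest (V : finType) (E : {set {set V}}) (e B : {set V}) :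
  uniform 4 E -> berge_triangle_free E -> e \in E -> B \in E -> #|B :&: e| = 3 ->
  cover (heavy_rest E e B) :\: e \subset outer E e :\: B.
Proof.
move=> un fr eE BE Be; apply/subsetP => c.
rewrite in_setD => /andP[ce /bigcupP[f fZ cf]]; rewrite in_setD.
have [fE fe fB fD [x xf xe]] := heavy_restP un fr eE BE Be fZ.
apply/andP; split.
  apply/negP => cB; move: fD; rewrite leqNgt => /negP; apply.
  apply/card_gt1P; exists x, c; rewrite !inE xf xe cf cB orbT; split=> //.
  by apply: contraNneq ce => <-.
apply/outerP; split=> //; exists f; split=> //.
by apply/meetingP; split=> //; exists x.
Qed.

(** The edges [e] and [B] are counted separately, and the rest edges draw on the outer vertices
    except the one in [B :\: e]. This gives [2 * 2 - 1 = 3] as the additive constant. *)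
Lemma meeting_card_heavy (V : finType) (E : {set {set V}}) (e B : {set V}) :
  uniform 4 E -> berge_triangle_free E -> e \in E -> B \in E -> #|B :&: e| = 3 ->
  2 * #|meeting E e| <= #|outer E e| + 3.
Proof.
move=> un fr eE BE Be; have h := heavy_rest_card un fr eE BE Be.
have h2 := subset_leq_card (cover_heavy_rest un fr eE BE Be).
have [u uB ue] : exists2 u, u \in B & u \notin e.
  have /card_gt0P[u] : 0 < #|B :\: e|.
    by move: (cardsID e B); rewrite Be (un B BE); clear; lia.
  by rewrite inE => /andP[]; exists u.
have uC : u \in outer E e.
  apply/outerP; split=> //; exists B; split=> //; first exact: trace3_meeting.
  exact: (trace3_neq un).
have h3 : #|outer E e :\: B| < #|outer E e|.
  apply: proper_card; apply/properP; split; first exact: subsetDl.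
  by exists u; rewrite // inE uB.
rewrite (card_heavy_rest un eE BE Be).
by move: h h2 h3; clear; lia.
Qed.

Lemma meeting_card (V : finType) (E : {set {set V}}) (e : {set V}) :
  uniform 4 E -> berge_triangle_free E -> e \in E ->
  2 * #|meeting E e| <= #|outer E e| + 3.
Proof.
move=> un fr eE.
have [/existsP[B /andP[BE /eqP Be]]|h] :=
  boolP [exists B : {set V}, (B \in E) && (#|B :&: e| == 3)].
  exact: (meeting_card_heavy un fr eE BE Be).
apply: leq_trans (meeting_card_light un fr eE _) _; last by rewrite leq_add2l.
move=> f fE; apply: contra h => /eqP fe; apply/existsP; exists f.
by rewrite fE fe eqxx.
Qed.

Lemma outer_sub (V : finType) (E : {set {set V}}) (W e : {set V}) :
  (forall f, f \in E -> f \subset W) -> outer E e \subset W :\: e.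
Proof.
move=> EW; apply/subsetP => c /outerP[ce [f [/meetingP[fE _] _ cf]]].
by rewrite inE ce (subsetP (EW f fE)).
Qed.

Lemma card_outer_le (V : finType) (E : {set {set V}}) (W e : {set V}) :
  uniform 4 E -> (forall f, f \in E -> f \subset W) -> e \in E ->
  #|outer E e| + 4 <= #|W|.
Proof.
move=> un EW eE; move: (subset_leq_card (outer_sub e EW)).
move: (subset_leq_card (EW e eE)).
by rewrite cardsD (setIidPr (EW e eE)) (un e eE); clear; lia.
Qed.

Lemma sum_share3 (T : finType) (A : {set T}) (F : T -> nat) :
  #|A| = 3 -> (forall c, c \in A -> F c = 1 \/ F c = 2) ->
  \sum_(c in A) F c = 4 ->
  exists c d, [/\ c \in A, d \in A, c != d, F c = 1 & F d = 1].
Proof.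
move=> /cards3P[x [y [z [xy xz yz ->]]]] h.
have hx : F x = 1 \/ F x = 2 by apply: h; rewrite !inE eqxx.
have hy : F y = 1 \/ F y = 2 by apply: h; rewrite !inE eqxx orbT.
have hz : F z = 1 \/ F z = 2 by apply: h; rewrite !inE eqxx orbT.
rewrite -setUA big_setU1 ?inE ?negb_or ?xy ?xz //= big_setU1 ?inE ?yz //= big_set1.
case: hx => hx; case: hy => hy; case: hz => hz; rewrite hx hy hz // => _.
- by exists x, y; rewrite !inE !eqxx ?orbT.
- by exists x, z; rewrite !inE !eqxx ?orbT.
- by exists y, z; rewrite !inE !eqxx ?orbT.
Qed.

(* The equality case of [meeting_card]. *)
Lemma exceptional (V : finType) (E : {set {set V}}) (W e : {set V}) :
  uniform 4 E -> berge_triangle_free E -> (forall f, f \in E -> f \subset W) ->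
  e \in E -> 2 * #|meeting E e| + 1 = #|W| ->
  exists B, [/\ B \in E, #|B :&: e| = 3, 
    forall f, f \in meeting E e -> exists2 g, g \in meeting E e & #|f :&: g| = 3,
    forall c, c \in W -> c \notin e -> c \in outer E e
    & #|W| %% 4 = 1].
Proof.
move=> un fr EW eE exc; have co := card_outer_le un EW eE.
have [/existsP[B /andP[BE /eqP Be]]|h] :=
  boolP [exists B : {set V}, (B \in E) && (#|B :&: e| == 3)]; last first.
  have : 2 * #|meeting E e| <= #|outer E e| + 2.
    apply: (meeting_card_light un fr eE) => f fE; apply: contra h => /eqP fe.
    by apply/existsP; exists f; rewrite fE fe eqxx.
  by move: exc co; clear; lia.
have cD := card_diamond un eE BE Be.
have cX := card_heavy_rest un eE BE Be.
set Z := heavy_rest E e B in cX.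
have ZP f : f \in Z -> _ := @heavy_restP _ E e B f un fr eE BE Be.
(* [lo] and [hi2] bound the same double sum from both sides; by [exc] the bounds agree, so every
   estimate in between is an equality. *)
have lo : #|Z| * 4 <= \sum_(f in Z) \sum_(c in f :\: e) share (deg Z c).
  rewrite -sum_nat_const; apply: leq_sum => f fZ; have [fE fe fB fD _] := ZP f fZ.
  apply: (@share_sum_ge4 _ E) => //.
    by apply: subset_trans (subsetDl _ _) (subsetDl _ _).
  apply: leq_trans (leqW fD).
  by apply: subset_leq_card; apply: setIS; apply: subsetUl.
have hi c : c \in cover Z :\: e -> deg Z c * share (deg Z c) <= 2.
  by move=> _; apply: mul_share_le.
have sub1 := cover_heavy_rest un fr eE BE Be; rewrite -/Z in sub1.
have DW : e :|: B \subset W by rewrite subUset !EW.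
have sub2 : outer E e :\: B \subset W :\: (e :|: B).
  have sW := outer_sub e EW; rewrite setDUr subsetI (subset_trans (subsetDl _ _) sW).
  exact: setSD (subset_trans sW (subsetDl _ _)).
have cWD : #|W :\: (e :|: B)| + 5 = #|W|.
  by rewrite -cD -(cardsID (e :|: B) W) (setIidPr DW) addnC.
have le1 := subset_leq_card sub1; have le2 := subset_leq_card sub2.
have hi2 : \sum_(c in cover Z :\: e) deg Z c * share (deg Z c)
    <= #|cover Z :\: e| * 2.
  by rewrite -sum_nat_const; apply: leq_sum => c /hi.
have eqS := share_sum_exchange Z e.
(* With [#|W| = #|W :\: (e :|: B)| + 5] and two edges in the diamond, [exc] reads
   [2 * #|Z| = #|W :\: (e :|: B)|]. *)
have cZ : 4 * #|Z| = 2 * #|W :\: (e :|: B)|.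
  by move: exc cX cWD; clear; lia.
have cC : #|cover Z :\: e| = #|W :\: (e :|: B)|.
  by move: lo eqS hi2 cZ le1 le2; clear; lia.
have eqC : cover Z :\: e = W :\: (e :|: B).
  by apply/eqP; rewrite eqEcard (subset_trans sub1 sub2) cC leqnn.
have degc c : c \in cover Z :\: e -> deg Z c = 1 \/ deg Z c = 2.
  move=> cC0; have: deg Z c * share (deg Z c) = 2.
    apply: (@sum_le_eq _ (cover Z :\: e) (fun c => deg Z c * share (deg Z c)) (fun=> 2)) => //.
    by rewrite sum_nat_const -eqS; apply: leq_trans lo; rewrite cC; move: cZ; clear; lia.
  by case: (deg Z c) => [|[|[|d]]] //; [left | right | rewrite /share /= muln0].
have shf f : f \in Z -> \sum_(c in f :\: e) share (deg Z c) = 4.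
  move=> fZ; apply/esym.
  apply: (@sum_le_eq _ Z (fun=> 4) (fun f => \sum_(c in f :\: e) share (deg Z c))) => //.
    move=> g gZ; have [gE ge gB gD _] := ZP g gZ.
    apply: (@share_sum_ge4 _ E) => //.
      by apply: subset_trans (subsetDl _ _) (subsetDl _ _).
    apply: leq_trans (leqW gD).
    by apply: subset_leq_card; apply: setIS; apply: subsetUl.
  rewrite sum_nat_const eqS; apply: leq_trans hi2 _; rewrite cC.
  by move: cZ; clear; lia.
have ZX : Z \subset meeting E e.
  by apply: subset_trans (subsetDl _ _) (subsetDl _ _).
(* Three shares, each 1 or 2, with sum 4 include two shares 1; the second edge [g] common to these
   two outer vertices also contains [a]. *)
have partner f : f \in Z -> exists g, [/\ g \in Z, g != f & #|f :&: g| = 3].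
  move=> fZ; have [fE fe fB fD [a af ae]] := ZP f fZ.
  have c3 : #|f :\: e| = 3.
    have c1 : #|f :&: e| <= 1.
      by apply: leq_trans fD; apply: subset_leq_card; apply: setIS; apply: subsetUl.
    have c0 : 0 < #|f :&: e| by apply/card_gt0P; exists a; rewrite inE af.
    by move: c1 c0 (cardsID e f); rewrite (un f fE); clear; lia.
  have [c|c [d [cf df cd sc sd]]] := sum_share3 c3 _ (shf f fZ).
    rewrite inE => /andP[ce cf]; case: (degc c) => [|->|->]; last by left.
      by rewrite inE ce; apply/bigcupP; exists f.
    by right.
  have nd x : share (deg Z x) = 1 -> deg Z x != 1 by apply: contra_eqN => /eqP->.
  move: cf df; rewrite !inE => /andP[ce cf] /andP[de df].
  have [g [gZ gf [ag cg dg] _]] :=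
    heavy_pair fr eE ZX fZ af ae cf df ce de cd (nd c sc) (nd d sd).
  exists g; split=> //; have [gE _ _ _ _] := ZP g gZ.
  apply/eqP; rewrite eqn_leq setIC (card_trace_le3 un fE gE gf) /=.
  apply/card_gt2P; exists a, c, d; rewrite !inE ag cg dg af cf df.
  split=> //; split; rewrite // 1?eq_sym //.
    by apply: contraNneq ce => ->.
  by apply: contraNneq de => <-.
exists B; split=> //.
- move=> f fX; have [->|fe] := eqVneq f e.
    by exists B; [exact: trace3_meeting | rewrite setIC].
  have [->|fB] := eqVneq f B; first by exists e; [exact: mem_meeting|].
  have fZ : f \in Z by rewrite !in_setD1 fe fB.
  by have [g [gZ _ fg]] := partner f fZ; exists g; rewrite // (subsetP ZX).
- move=> c cW ce; have [cB|cB] := boolP (c \in B).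
    apply/outerP; split=> //; exists B; split=> //; first exact: trace3_meeting.
    exact: (trace3_neq un eE Be).
  have : c \in cover Z :\: e by rewrite eqC !inE negb_or ce cB.
  by move/(subsetP sub1); rewrite inE => /andP[].
have inj f g h : f \in Z -> g \in Z -> h \in Z -> #|f :&: g| = 3 -> #|f :&: h| = 3 -> h = g.
  move=> /ZP[fE _ _ _ _] /ZP[gE _ _ _ _] /ZP[hE _ _ _ _] fg fh.
  by apply: (trace3_unique un fr fE gE hE); rewrite setIC.
(* Partners are unique by [inj], so [R] splits [Z] into pairs. Hence [#|Z|] is even and
   [#|W| = 2 * #|Z| + 5] is 1 modulo 4. *)
pose R (f g : {set V}) := (f == g) || (#|f :&: g| == 3).
have Req : {in Z & &, equivalence_rel R}.
  move=> f g h fZ gZ hZ; split; first by rewrite /R eqxx.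
  rewrite {1}/R => /orP[/eqP-> //|/eqP fg]; rewrite /R.
  have [<-|fh] /= := eqVneq f h.
    by rewrite setIC fg eqxx orbT.
  have gf : #|g :&: f| = 3 by rewrite setIC.
  apply/eqP/orP => [fh3|[/eqP<- //|/eqP gh3]].
    by left; apply/eqP/esym; apply: (inj f).
  by move: fh; rewrite (inj g f h) ?eqxx.
have /card_uniform_partition : {in equivalence_partition R Z, forall A : {set {set V}}, #|A| = 2}.
  move=> A /imsetP[f fZ ->].
  have [g [gZ gf fg]] := partner f fZ.
  have -> : [set y in Z | R f y] = [set f; g].
    apply/setP => h; rewrite in_set in_set2 /R; apply/andP/orP.
      case=> hZ /orP[/eqP->|/eqP fh]; first by left.
      by right; apply/eqP; apply: (inj f).
    case=> /eqP->; first by rewrite fZ eqxx.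
    by rewrite gZ fg eqxx orbT.
  by rewrite cards2 eq_sym gf.
move=> /(_ Z (equivalence_partitionP Req)) cZ2.
have {}cZ2 : #|Z| = #|equivalence_partition R Z| * 2 by [].
by move: exc cX cWD cZ2 cZ; clear; lia.
Qed.

(** * The upper bound for 4-graphs *)

Definition max_matching (V : finType) (E M : {set {set V}}) : Prop :=
  [/\ M \subset E, trivIset M &
      forall M' : {set {set V}}, M' \subset E -> trivIset M' -> #|M'| <= #|M|].

Definition away (V : finType) (E : {set {set V}}) (e : {set V}) :=
  [set f in E | [disjoint f & e]].

Lemma away_sub (V : finType) (E : {set {set V}}) (e : {set V}) : away E e \subset E.
Proof. by apply/subsetP => f; rewrite inE => /andP[]. Qed.

Lemma card_meeting_away (V : finType) (E : {set {set V}}) (e : {set V}) :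
  #|E| = #|meeting E e| + #|away E e|.
Proof.
rewrite -(cardsID (meeting E e) E); congr (_ + _); apply: eq_card => f.
  by rewrite !inE; case: (f \in E).
by rewrite !inE; case: (f \in E); rewrite //= ?andbT ?negbK.
Qed.

Lemma uniformS (V : finType) r (E F : {set {set V}}) :
  F \subset E -> uniform r E -> uniform r F.
Proof. by move=> /subsetP FE un e /FE /un. Qed.

Lemma btfS (V : finType) (E F : {set {set V}}) :
  F \subset E -> berge_triangle_free E -> berge_triangle_free F.
Proof.
move=> /subsetP FE fr [e1 [e2 [e3 [x [y [z [[h1 h2 h3] h4 h5 h6]]]]]]].
by apply: fr; exists e1, e2, e3, x, y, z; split=> //; split; apply: FE.
Qed.

Lemma trivIset_disjoint (V : finType) (M : {set {set V}}) (e f : {set V}) :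
  trivIset M -> e \in M -> f \in M -> e != f -> [disjoint e & f].
Proof. by move=> /trivIsetP h eM fM; apply: h. Qed.

Lemma away_sub_W (V : finType) (E : {set {set V}}) (W e : {set V}) :
  (forall f, f \in E -> f \subset W) -> forall f, f \in away E e -> f \subset W :\: e.
Proof.
by move=> EW f; rewrite inE => /andP[fE dfe]; rewrite subsetD EW.
Qed.

(** Adding [e] to a matching of [away E e] gives a matching of [E] with one edge more; [e] is
    nonempty since [0 < r], so it is not itself in [away E e]. *)
Lemma max_matching_away (V : finType) r (E M : {set {set V}}) (e : {set V}) :
  0 < r -> uniform r E -> max_matching E M -> e \in M ->
  max_matching (away E e) (M :\ e).
Proof.
move=> r0 un [ME tM mM] eM; have eE := subsetP ME e eM; split.
- apply/subsetP => f; rewrite !inE => /andP[fe fM].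
  by rewrite (subsetP ME f fM) (trivIset_disjoint tM).
- by apply: trivIsetS tM; apply: subsetDl.
move=> M' M'E tM'.
have eM' : e \notin M'.
  apply/negP => /(subsetP M'E); rewrite inE eE -setI_eq0 setIid -cards_eq0.
  by rewrite (un e eE); case: r r0 {un}.
have : #|e |: M'| <= #|M|.
  apply: mM.
    by rewrite subUset sub1set eE (subset_trans M'E (away_sub _ _)).
  apply/trivIsetP => f g; rewrite !inE => /orP[/eqP->|fM] /orP[/eqP->|gM].
  - by rewrite eqxx.
  - by move=> _; move/(subsetP M'E): gM; rewrite inE disjoint_sym => /andP[].
  - by move=> _; move/(subsetP M'E): fM; rewrite inE => /andP[].
  - exact: (trivIsetP tM').
by rewrite cardsU1 eM' (cardsD1 e M) eM.
Qed.

Lemma card_disjoint_setU (T : finType) (A B : {set T}) :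
  [disjoint A & B] -> #|A :|: B| = #|A| + #|B|.
Proof. by move=> /disjoint_setI0 h; rewrite cardsU h cards0 subn0. Qed.

Lemma disjoint_setU (T : finType) (A B C : {set T}) :
  [disjoint A & B :|: C] = [disjoint A & B] && [disjoint A & C].
Proof. by rewrite -!setI_eq0 setIUr setU_eq0. Qed.

Lemma disjoint_setD (T : finType) (A B : {set T}) : [disjoint A & B :\: A].
Proof. by rewrite -setI_eq0 setIDA setDIl setDv set0I. Qed.

Lemma card_matching_le (V : finType) r (E M : {set {set V}}) (W : {set V}) :
  uniform r E -> (forall f, f \in E -> f \subset W) -> M \subset E -> trivIset M ->
  r * #|M| <= #|W|.
Proof.
move=> un EW ME /eqP tM.
have -> : r * #|M| = #|cover M|.
  rewrite -tM mulnC -sum_nat_const; apply: eq_bigr => e eM.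
  by rewrite un // (subsetP ME).
by apply: subset_leq_card; apply/bigcupsP => e eM; apply: EW; apply: (subsetP ME).
Qed.

Lemma meeting_away_notin (V : finType) (E : {set {set V}}) (e e' f : {set V}) :
  f \in meeting (away E e) e' -> f \notin meeting E e.
Proof. by rewrite !inE => /andP[/andP[-> ->]]. Qed.

(** Every edge meeting the exceptional [e] lies in a diamond. At least three vertices of [e'] lie
    outside [B]; the edge joining each of them to [e] has two further vertices, which no edge
    meeting [e'] and avoiding [e] can contain. With [e] and [e'] this excludes 14 vertices, so [e']
    adds at most [(|W| - 11) / 2] edges. *)
Lemma exceptional_pair (V : finType) (E : {set {set V}}) (W e e' : {set V}) :
  uniform 4 E -> berge_triangle_free E -> (forall f, f \in E -> f \subset W) ->
  e \in E -> e' \in E -> [disjoint e & e'] -> 2 * #|meeting E e| + 1 = #|W| ->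
  #|meeting E e| + #|meeting (away E e) e'| + 6 <= #|W|.
Proof.
move=> un fr EW eE e'E dee exc.
have [B [BE Be partner cov _]] := exceptional un fr EW eE exc.
have me' x : x \in e' -> x \notin e by apply: contraL => /(disjointFr dee) ->.
have eX : e' \notin meeting E e by rewrite inE disjoint_sym dee andbF.
have ne f : f \in meeting E e -> f != e' by apply: contraTneq => ->.
have nee : e' != e by rewrite eq_sym ne // mem_meeting.
have neB : e' != B by rewrite eq_sym ne // trace3_meeting.
pose Y := outer (away E e) e'.
have K v : v \in e' -> v \notin B -> exists f,
    [/\ f \in meeting E e, v \in f, f :&: e' = [set v], #|f :\: e :\: e'| = 2
      & [disjoint Y & f]].
  move=> ve' vB.
  have /outerP[ve [f [fX fe vf]]] := cov v (subsetP (EW e' e'E) v ve') (me' v ve').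
  have [fE [a af ae]] := meetingP _ _ _ fX.
  have fB : f != B by apply: contraNneq vB => <-.
  have [g gX fg] := partner f fX; have [gE _] := meetingP _ _ _ gX.
  have f1 : #|f :&: (e :|: B)| <= 1 by apply: (diamond_meet un) => //; rewrite setIC.
  have e'1 : #|e' :&: (f :|: g)| <= 1.
    by apply: (diamond_meet un) => //; rewrite eq_sym ne.
  have fe' : f :&: e' = [set v].
    apply/esym/eqP; rewrite eqEcard cards1; apply/andP; split.
      by apply/subsetP => x; rewrite !inE => /eqP->; rewrite vf.
    apply: leq_trans e'1; apply: subset_leq_card.
    by rewrite setIC setIS // subsetUl.
  have cfe : #|f :&: e| = 1.
    apply/eqP; rewrite eqn_leq; apply/andP; split.
      by apply: leq_trans f1; apply: subset_leq_card; rewrite setIS // subsetUl.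
    by apply/card_gt0P; exists a; rewrite inE af.
  exists f; split=> //.
    have cv : #|(f :\: e) :&: e'| = 1.
      rewrite -(cards1 v) -fe'; apply: eq_card => x; rewrite !inE.
      by case xe': (x \in e'); rewrite ?andbF // me'.
    by move: (cardsID e f) (cardsID e' (f :\: e)); rewrite cfe cv (un f fE); clear; lia.
  (* An edge [h] that avoids [e], meets [e'] and shares [p] with [f] must pass through [v]; then it
     has two vertices in the diamond [f], [g]. *)
  rewrite disjoint_subset; apply/subsetP => p /outerP[pe' [h [hX hne ph]]].
  rewrite inE; apply/negP => pf.
  have [/[!inE]/andP[hE dhe] [y yh ye']] := meetingP _ _ _ hX.
  have hnX := meeting_away_notin hX.
  have hf : h != f by apply: contraNneq hnX => ->.
  have hg : h != g by apply: contraNneq hnX => ->.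
  have yv := trace_eq fr e'E fE hE hf pf ph pe' vf ve' yh ye'.
  have := diamond_meet un fr fE gE hE fg hf hg.
  apply/negP; rewrite -ltnNge; apply/card_gt1P; exists p, v.
  rewrite !inE pf ph vf -{1}yv yh; split=> //.
  by apply: contraNneq pe' => ->.
have e'1 : #|e' :&: (e :|: B)| <= 1 by apply: (diamond_meet un) => //; rewrite setIC.
have : 2 < #|e' :\: B|.
  have : #|e' :&: B| <= 1.
    by apply: leq_trans e'1; apply: subset_leq_card; rewrite setIS // subsetUr.
  by move: (cardsID B e'); rewrite (un e' e'E); clear; lia.
case/card_gt2P => v1 [v2 [v3 [[]]]]; rewrite !inE.
move=> /andP[v1B v1e] /andP[v2B v2e] /andP[v3B v3e] [v12 v23 v31].
have [f1 [f1X v1f f1e c1 d1]] := K v1 v1e v1B.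
have [f2 [f2X v2f f2e c2 d2]] := K v2 v2e v2B.
have [f3 [f3X v3f f3e c3 d3]] := K v3 v3e v3B.
(* Edges sharing a vertex outside [e'] meet [e'] in the same vertex, so the three pairs are
   disjoint. *)
have disjQ f g v w : v \in e' -> w \in e' -> v != w -> f \in meeting E e ->
    g \in meeting E e -> v \in f -> w \in g -> f :&: e' = [set v] ->
    [disjoint f :\: e :\: e' & g :\: e :\: e'].
  move=> ve we vw /meetingP[fE _] /meetingP[gE _] vf wg fe.
  rewrite disjoint_subset; apply/subsetP => p; rewrite !inE => /and3P[pe' _ pf].
  apply/negP => /and3P[_ _ pg].
  have fg : g != f.
    apply: contraNneq vw => gf; have : w \in f :&: e' by rewrite inE -gf wg.
    by rewrite fe inE eq_sym.
  by move: vw; rewrite (trace_eq fr e'E fE gE fg pf pg pe' vf ve wg we) eqxx.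
pose P := e :|: (e' :|: (f1 :\: e :\: e' :|: (f2 :\: e :\: e' :|: f3 :\: e :\: e'))).
have cP : #|P| = 14.
  rewrite /P !card_disjoint_setU ?c1 ?c2 ?c3 ?(un e eE) ?(un e' e'E) //.
  - exact: (disjQ f2 f3 v2 v3).
  - by rewrite disjoint_setU (disjQ f1 f2 v1 v2) // (disjQ f1 f3 v1 v3) // eq_sym.
  - by rewrite !disjoint_setU !disjoint_setD.
  have dQ f : [disjoint e & f :\: e :\: e'] by rewrite setDDl setUC -setDDl disjoint_setD.
  by rewrite !disjoint_setU dee !dQ.
have sP : P \subset W.
  have sf f : f \in meeting E e -> f :\: e :\: e' \subset W.
    move=> /meetingP[fE _]; apply: subset_trans (subsetDl _ _) _.
    exact: subset_trans (subsetDl _ _) (EW f fE).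
  by rewrite !subUset !sf // !EW.
have sY : Y \subset W :\: P.
  apply/subsetP => p pY.
  have := subsetP (outer_sub e' (away_sub_W (e := e) EW)) p pY.
  rewrite !inE => /and3P[/negPf-> /negPf-> ->].
  by rewrite (disjointFr d1 pY) (disjointFr d2 pY) (disjointFr d3 pY).
have cY : #|Y| + 14 <= #|W|.
  rewrite -cP -(cardsID P W) (setIidPr sP) addnC leq_add2l.
  exact: subset_leq_card.
have e'A : e' \in away E e by rewrite inE e'E disjoint_sym.
have := meeting_card (uniformS (away_sub E e) un) (btfS (away_sub E e) fr) e'A.
by rewrite -/Y; move: cY exc; clear; lia.
Qed.

(** When [e'] is exceptional among the edges avoiding [e], an edge [f] meeting both consists of
    three vertices of [e] and one of [e']: any other vertex would give [f] two vertices in some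
    diamond. By [trace3_unique] there is at most one such [f], so at most one vertex of [e'] is in
    [outer E e], and the bound from [meeting_card] drops by 3. *)
Lemma exceptional_away (V : finType) (E : {set {set V}}) (W e e' : {set V}) :
  uniform 4 E -> berge_triangle_free E -> (forall f, f \in E -> f \subset W) ->
  e \in E -> e' \in E -> [disjoint e & e'] ->
  2 * #|meeting (away E e) e'| + 1 = #|W :\: e| ->
  2 * #|meeting E e| + 4 <= #|W|.
Proof.
move=> un fr EW eE e'E dee exc.
have un' := uniformS (away_sub E e) un; have fr' := btfS (away_sub E e) fr.
have e'A : e' \in away E e by rewrite inE e'E disjoint_sym.
have [B [BA Be partner cov _]] :=
  exceptional un' fr' (away_sub_W (e := e) EW) e'A exc.
have BE : B \in E := subsetP (away_sub _ _) B BA.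
have nA f g : f \in meeting E e -> g \in away E e -> f != g.
  by rewrite !inE => /andP[_ h1] /andP[_ h2]; apply: contraNneq h1 => ->.
have K f y : f \in meeting E e -> y \in f -> y \in e' -> f :\: e = [set y].
  move=> fX yf ye'; have [fE _] := meetingP _ _ _ fX.
  have ye : y \notin e by rewrite (disjointFl dee).
  apply/setP => p; rewrite !inE; apply/andP/eqP => [[pe pf]|->] //.
  apply/eqP/negPn/negP => py.
  have : #|f :&: (e' :|: B)| <= 1.
    by apply: (diamond_meet un) => //; rewrite ?nA // setIC.
  have [pe'|pe' _] := boolP (p \in e').
    apply/negP; rewrite -ltnNge; apply/card_gt1P; exists p, y.
    by rewrite !inE pf pe' yf ye'.
  (* Such a [p] is joined to [e'] by some [h] avoiding [e], which contains [y] by [trace_eq]; then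
     [f] meets the diamond of [h] and its partner in [p] and [y]. *)
  have /outerP[_ [h [hX hne ph]]] : p \in outer (away E e) e'.
    by apply: cov => //; rewrite inE pe (subsetP (EW f fE)).
  have [hA [z zh ze']] := meetingP _ _ _ hX.
  have hE := subsetP (away_sub _ _) h hA.
  have zy := trace_eq fr e'E fE hE _ pf ph pe' yf ye' zh ze'.
  have {}zy : z = y by apply: zy; rewrite eq_sym nA.
  have [g gX hg] := partner h hX; have [gA _] := meetingP _ _ _ gX.
  have gE := subsetP (away_sub _ _) g gA.
  have := diamond_meet un fr hE gE fE hg (nA f h fX hA) (nA f g fX gA).
  apply/negP; rewrite -ltnNge; apply/card_gt1P; exists p, y.
  by rewrite zy in zh; rewrite !inE pf ph yf zh.
have K3 f y : f \in meeting E e -> y \in f -> y \in e' -> #|f :&: e| = 3.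
  move=> fX yf ye'; have [fE _] := meetingP _ _ _ fX.
  by move: (cardsID e f); rewrite (K f y) // cards1 (un f fE); clear; lia.
have c1 : #|outer E e :&: e'| <= 1.
  rewrite leqNgt; apply/negP => /card_gt1P[y1 [y2 []]].
  rewrite !in_setI => /andP[/outerP[_ [f1 [f1X _ y1f]]] y1e].
  move=> /andP[/outerP[_ [f2 [f2X _ y2f]]] y2e].
  have [f1E _] := meetingP _ _ _ f1X; have [f2E _] := meetingP _ _ _ f2X.
  have f12 := trace3_unique un fr eE f1E f2E (K3 _ _ f1X y1f y1e) (K3 _ _ f2X y2f y2e).
  have : y2 \in f1 :\: e by rewrite inE -f12 y2f (disjointFl dee).
  by rewrite (K f1 y1) // inE eq_sym => ->.
have cW : #|outer E e :\: e'| + 8 <= #|W|.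
  have s1 : outer E e :\: e' \subset W :\: (e :|: e').
    rewrite -setDDl setSD //; exact: outer_sub.
  have s2 : e :|: e' \subset W by rewrite subUset !EW.
  have c2 : #|e :|: e'| = 8 by rewrite card_disjoint_setU // (un e eE) (un e' e'E).
  rewrite -c2 -(cardsID (e :|: e') W) (setIidPr s2) addnC leq_add2l.
  exact: subset_leq_card.
move: (meeting_card un fr eE) c1 cW; rewrite -(cardsID e' (outer E e)).
by clear; lia.
Qed.

Lemma matching_meets (V : finType) r (E M : {set {set V}}) (f : {set V}) :
  0 < r -> uniform r E -> max_matching E M -> f \in E ->
  exists2 e, e \in M & ~~ [disjoint f & e].
Proof.
move=> r0 un [ME tM mM] fE; apply/exists_inP; apply: contraT => h.
have dis e : e \in M -> [disjoint f & e].
  by move=> eM; apply: contraNT h => h; apply/exists_inP; exists e.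
have fM : f \notin M.
  apply/negP => /dis; rewrite -setI_eq0 setIid -cards_eq0 (un f fE).
  by case: r r0 {un}.
have : #|f |: M| <= #|M|.
  apply: mM; first by rewrite subUset sub1set fE.
  apply/trivIsetP => a b; rewrite !inE => /orP[/eqP->|aM] /orP[/eqP->|bM].
  - by rewrite eqxx.
  - by move=> _; apply: dis.
  - by move=> _; rewrite disjoint_sym; apply: dis.
  - exact: (trivIsetP tM).
by rewrite cardsU1 fM ltnn.
Qed.

Lemma matching0_empty (V : finType) r (E M : {set {set V}}) :
  0 < r -> uniform r E -> max_matching E M -> #|M| = 0 -> E = set0.
Proof.
move=> r0 un mM M0; apply/setP => f; rewrite inE; apply/negP => fE.
have [e] := matching_meets r0 un mM fE; rewrite (cards0_eq M0) inE //.
Qed.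

Lemma matching1_star (V : finType) r (E M : {set {set V}}) (e : {set V}) :
  0 < r -> uniform r E -> max_matching E M -> #|M| = 1 -> e \in M ->
  meeting E e = E.
Proof.
move=> r0 un mM /eqP/cards1P[e' eM] /[!(eM, inE)] /eqP->.
apply/setP => f; rewrite inE andb_idr // => fE.
by have [e0] := matching_meets r0 un mM fE; rewrite eM inE => /eqP->.
Qed.

Lemma card_setD1_matching (V : finType) (M : {set {set V}}) (e : {set V}) :
  e \in M -> #|M :\ e| = #|M| - 1.
Proof. by move=> eM; rewrite (cardsD1 e M) eM addnC addnK. Qed.

(** All edges meet the single matching edge, so [meeting_card] and its equality case [exceptional]
    apply to the whole of [E]. *)
Lemma upper4_star (V : finType) (E M : {set {set V}}) (W : {set V}) :
  uniform 4 E -> berge_triangle_free E -> (forall f, f \in E -> f \subset W) ->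
  max_matching E M -> #|M| = 1 ->
  2 * #|E| + 1 <= #|W| /\ (2 * #|E| + 1 = #|W| -> #|W| %% 4 = 1).
Proof.
move=> un fr EW mM M1; have [e eM] : exists e : {set V}, e \in M.
  by apply/set0Pn; rewrite -card_gt0 M1.
have eE : e \in E by case: mM => /subsetP h _ _; apply: h.
rewrite -(matching1_star _ un mM M1 eM) //; split.
  by move: (meeting_card un fr eE) (card_outer_le un EW eE); clear; lia.
by move=> exc; have [B []] := exceptional un fr EW eE exc.
Qed.

(** For deleting two matching edges at once, which together meet at most [n - 6] edges. With
    [n = 2 * (s + 2 + m) + 1] the two sides are [s * m + 2 * s - 1] and [s * m + 2 * s]. *)
Lemma upper4_arith1 s n : 3 < s -> odd n -> 4 * s <= n ->
  n - 6 + (s - 2) * ((n - 8 - 2 * (s - 2)) %/ 2) <= s * ((n - 2 * s) %/ 2).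
Proof.
move=> s3 on sn; have [m en] : exists m, n = 2 * (s + 2 + m) + 1.
  by exists (n./2 - s - 2); move: s3 on sn; clear; lia.
have -> : (n - 8 - 2 * (s - 2)) %/ 2 = m by move: s3 sn; rewrite en; clear; lia.
have -> : (n - 2 * s) %/ 2 = m + 2 by move: s3 sn; rewrite en; clear; lia.
by rewrite en; move: s3; clear; nia.
Qed.

(** An equality, not just a bound: [extremal4_split] uses it to pass extremality to a smaller
    graph. *)
Lemma upper4_arith2 s n : 1 < s -> 4 * s <= n ->
  n %/ 2 - 1 + (s - 1) * ((n - 4 - 2 * (s - 1)) %/ 2) = s * ((n - 2 * s) %/ 2).
Proof.
move=> s3 sn; have [m em] : exists m, n %/ 2 = s + 1 + m.
  by exists (n %/ 2 - s - 1); move: s3 sn; clear; lia.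
have -> : (n - 4 - 2 * (s - 1)) %/ 2 = m by move: s3 sn em; clear; lia.
have -> : (n - 2 * s) %/ 2 = m + 1 by move: s3 sn em; clear; lia.
by rewrite em; move: s3; clear; nia.
Qed.

(** The value [s = 1] is excluded because a star can have one edge more than the formula gives;
    every induction step that leaves one matching edge is therefore treated through [upper4_star].
    The set [W] makes it possible to drop the vertices of a deleted edge. *)
Lemma upper4 (V : finType) (s : nat) (E M : {set {set V}}) (W : {set V}) :
  uniform 4 E -> berge_triangle_free E -> (forall f, f \in E -> f \subset W) ->
  max_matching E M -> #|M| = s -> s != 1 ->
  #|E| <= s * ((#|W| - 2 * s) %/ 2).
Proof.
elim/ltn_ind: s E M W => s IH E M W un fr EW mM cM s1.
have [s0|s0] := posnP s.
  by rewrite (matching0_empty _ un mM) ?cards0 // cM.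
have [ME tM _] := mM.
have [e eM] : exists e : {set V}, e \in M by apply/set0Pn; rewrite -card_gt0 cM.
have [|e' e'M nee] := @exists_neq _ M e; first by move: cM s0 s1; clear; lia.
have eE := subsetP ME e eM; have e'E := subsetP ME e' e'M.
have dee : [disjoint e & e'] by apply: (trivIset_disjoint tM); rewrite // eq_sym.
have cW : 4 * s <= #|W| by rewrite -cM; apply: (card_matching_le un EW).
have un0 := uniformS (away_sub E e) un; have fr0 := btfS (away_sub E e) fr.
have EW0 := away_sub_W (e := e) EW.
have cW0 : #|W :\: e| + 4 = #|W|.
  by move: (cardsID e W); rewrite (setIidPr (EW e eE)) (un e eE); clear; lia.
have mM0 := max_matching_away (isT : 0 < 4) un mM eM.
have cM0 : #|M :\ e| = s - 1 by rewrite card_setD1_matching // cM.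
have e'A : e' \in away E e by rewrite inE e'E disjoint_sym.
have cX := meeting_card un fr eE; have cC := card_outer_le un EW eE.
have cE := card_meeting_away E e.
(* If [e] is exceptional, then [|W|] is odd, and [e] and [e'] are deleted together, leaving matching
   number [s - 2]. *)
have [exc|nexc] := eqVneq (2 * #|meeting E e| + 1) #|W|.
  have lo := exceptional_pair un fr EW eE e'E dee exc.
  have un1 := uniformS (away_sub _ e') un0; have fr1 := btfS (away_sub _ e') fr0.
  have EW1 := away_sub_W (e := e') EW0.
  have e'M0 : e' \in M :\ e by rewrite in_setD1 nee.
  have mM1 := max_matching_away (isT : 0 < 4) un0 mM0 e'M0.
  have cM1 : #|M :\ e :\ e'| = s - 2 by rewrite card_setD1_matching // cM0 -subnDA.
  have cE0 := card_meeting_away (away E e) e'.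
  have cW1 : #|W :\: e :\: e'| + 4 = #|W :\: e|.
    move: (cardsID e' (W :\: e)); rewrite (setIidPr (EW0 e' e'A)) (un e' e'E).
    by clear; lia.
  have [s2|s2] := eqVneq s 2.
    have e0 : #|M :\ e :\ e'| = 0 by rewrite cM1 s2.
    rewrite cE cE0 (matching0_empty _ un1 mM1 e0) // cards0.
    by move: lo exc cW; rewrite s2; clear; lia.
  have [s3|s3] := eqVneq s 3.
    have e1 : #|M :\ e :\ e'| = 1 by rewrite cM1 s3.
    have [up _] := upper4_star un1 fr1 EW1 mM1 e1.
    by rewrite cE cE0; move: up lo exc cW cW0 cW1; rewrite s3; clear; lia.
  have e2 := cM1.
  have lt : s - 2 < s by move: s0; clear; lia.
  have ne1 : s - 2 != 1 by move: s3; clear; lia.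
  have up := IH _ lt _ _ _ un1 fr1 EW1 mM1 e2 ne1.
  have ge4 : 3 < s by move: s0 s1 s2 s3; clear; lia.
  have on : odd #|W| by move: exc; clear; lia.
  apply: leq_trans (upper4_arith1 ge4 on cW).
  have eW : #|W :\: e :\: e'| = #|W| - 8 by move: cW0 cW1; clear; lia.
  by rewrite cE cE0; move: up lo; rewrite eW; move: (_ * _); clear; lia.
(* Deleting [e] leaves a star. If that star attains [(|W :\: e| - 1) / 2], then [exceptional_away]
   improves the bound for [e] instead. *)
have [s2|s2] := eqVneq s 2.
  have e1 : #|M :\ e| = 1 by rewrite cM0 s2.
  have [up _] := upper4_star un0 fr0 EW0 mM0 e1.
  have e'M0 : e' \in M :\ e by rewrite in_setD1 nee.
  have eqA := matching1_star (isT : 0 < 4) un0 mM0 e1 e'M0.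
  have [exc'|nexc'] := eqVneq (2 * #|away E e| + 1) #|W :\: e|.
    have := exceptional_away un fr EW eE e'E dee; rewrite eqA => /(_ exc').
    by rewrite cE; move: exc' cW cW0; rewrite s2; clear; lia.
  by rewrite cE; move: cX cC up nexc nexc' cW cW0; rewrite s2; clear; lia.
have e2 := cM0.
have lt : s - 1 < s by move: s0; clear; lia.
have ne1 : s - 1 != 1 by move: s2; clear; lia.
have up := IH _ lt _ _ _ un0 fr0 EW0 mM0 e2 ne1.
have ge3 : 2 < s by move: s0 s1 s2; clear; lia.
(* A nonexceptional [e] meets at most [|W| / 2 - 1] edges, the first term of [upper4_arith2]. *)
rewrite -(upper4_arith2 (ltnW ge3) cW) cE leq_add //.
  by move: nexc cX cC; clear; lia.
have <- : #|W :\: e| = #|W| - 4 by move: cW0; clear; lia.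
exact: up.
Qed.

(** * Complete bipartite graphs of blocks *)

(** The common form of [H3] and [H4_grid], where the blocks [Y j] have size 1 and 2 respectively. *)
Definition bigrid (T : finType) (s m : nat) (P : 'I_s -> {set T})
    (Y : 'I_m -> {set T}) : {set {set T}} :=
  [set P ij.1 :|: Y ij.2 | ij : 'I_s * 'I_m].

(** One family for both kinds of blocks, so that disjointness and covering become single
    statements. *)
Definition join_fam (T : Type) (s m : nat) (P : 'I_s -> T) (Y : 'I_m -> T)
    (k : 'I_s + 'I_m) : T :=
  match k with inl i => P i | inr j => Y j end.

Definition blocks (T : finType) (s m t : nat) (P : 'I_s -> {set T})
    (Y : 'I_m -> {set T}) : Prop :=
  [/\ forall i, #|P i| = 2, forall j, #|Y j| = t &
      forall k l x, x \in join_fam P Y k -> x \in join_fam P Y l -> k = l].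

Lemma bigridP (T : finType) (s m : nat) (P : 'I_s -> {set T})
    (Y : 'I_m -> {set T}) (e : {set T}) :
  reflect (exists i j, e = P i :|: Y j) (e \in bigrid P Y).
Proof.
apply: (iffP imsetP) => [[[i j] _ ->]|[i [j ->]]]; first by exists i, j.
by exists (i, j).
Qed.

Lemma blocksPP (T : finType) s m t (P : 'I_s -> {set T}) (Y : 'I_m -> {set T}) i j x :
  blocks t P Y -> x \in P i -> x \in P j -> i = j.
Proof. by move=> [_ _ h] xi xj; case: (h (inl i) (inl j) x xi xj). Qed.

Lemma blocksYY (T : finType) s m t (P : 'I_s -> {set T}) (Y : 'I_m -> {set T}) i j x :
  blocks t P Y -> x \in Y i -> x \in Y j -> i = j.
Proof. by move=> [_ _ h] xi xj; case: (h (inr i) (inr j) x xi xj). Qed.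

Lemma blocksPY (T : finType) s m t (P : 'I_s -> {set T}) (Y : 'I_m -> {set T}) i j x :
  blocks t P Y -> x \in P i -> x \in Y j -> False.
Proof. by move=> [_ _ h] xi xj; have := h (inl i) (inr j) x xi xj. Qed.

Lemma bigrid_uniform (T : finType) s m t (P : 'I_s -> {set T}) (Y : 'I_m -> {set T}) :
  blocks t P Y -> uniform (2 + t) (bigrid P Y).
Proof.
move=> b e /bigridP[i [j ->]]; have [cP cY _] := b.
rewrite card_disjoint_setU ?cP ?cY // disjoint_subset.
by apply/subsetP => x xP; rewrite inE; apply/negP; apply: (blocksPY b xP).
Qed.

Lemma block_nonempty (T : finType) s m t (P : 'I_s -> {set T}) (Y : 'I_m -> {set T}) :
  blocks t P Y -> forall i, exists x, x \in P i.
Proof. by case=> cP _ _ i; apply/card_gt0P; rewrite cP. Qed.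

Lemma blockY_nonempty (T : finType) s m t (P : 'I_s -> {set T}) (Y : 'I_m -> {set T}) :
  0 < t -> blocks t P Y -> forall j, exists x, x \in Y j.
Proof. by move=> t0 [_ cY _] j; apply/card_gt0P; rewrite cY. Qed.

Lemma bigrid_inj (T : finType) s m t (P : 'I_s -> {set T}) (Y : 'I_m -> {set T}) i j k l :
  0 < t -> blocks t P Y -> P i :|: Y j = P k :|: Y l -> i = k /\ j = l.
Proof.
move=> t0 b eq; have [x xi] := block_nonempty b i.
have [y yj] := blockY_nonempty t0 b j.
have : x \in P k :|: Y l by rewrite -eq inE xi.
have : y \in P k :|: Y l by rewrite -eq inE yj orbT.
rewrite !inE => /orP[yk|yl]; first by case: (blocksPY b yk yj).
by case/orP => [xk|xl]; [rewrite (blocksPP b xi xk) (blocksYY b yj yl)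
  | case: (blocksPY b xi xl)].
Qed.

Lemma card_bigrid (T : finType) s m t (P : 'I_s -> {set T}) (Y : 'I_m -> {set T}) :
  0 < t -> blocks t P Y -> #|bigrid P Y| = s * m.
Proof.
move=> t0 b; rewrite card_imset ?card_prod ?card_ord //.
by move=> [i j] [k l] /= /(bigrid_inj t0 b)[-> ->].
Qed.

(** A vertex common to two edges lies in a block common to both. If the three vertices of a triangle
    all lie in [P] blocks, or all in [Y] blocks, these are one block, of size at most 2. Otherwise
    two of the three edges agree in both indices. *)
Lemma bigrid_btf (T : finType) s m t (P : 'I_s -> {set T}) (Y : 'I_m -> {set T}) :
  t <= 2 -> blocks t P Y -> berge_triangle_free (bigrid P Y).
Proof.
move=> t2 b [e1 [e2 [e3 [x [y [z [[/bigridP[i1 [j1 h1]] /bigridP[i2 [j2 h2]]]]]]]]]].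
case/bigridP=> i3 [j3 h3] [n12 n23 n13] [xy yz xz] [s1 s2 s3].
have tri (A : {set T}) : #|A| <= 2 -> x \in A -> y \in A -> z \in A -> False.
  rewrite leqNgt => /negP h xA yA zA; apply: h; apply/card_gt2P.
  by exists x, y, z; split=> //; split; rewrite // eq_sym.
have mem (u v : T) (e : {set T}) : [set u; v] \subset e -> u \in e /\ v \in e.
  by rewrite subUset !sub1set => /andP[].
have sep (w : T) i j k l : w \in P i :|: Y j -> w \in P k :|: Y l ->
    (w \in P i /\ i = k) \/ (w \in Y j /\ j = l).
  rewrite !inE => /orP[wi|wj] /orP[wk|wl].
  - by left; rewrite (blocksPP b wi wk).
  - by case: (blocksPY b wi wl).
  - by case: (blocksPY b wk wj).
  - by right; rewrite (blocksYY b wj wl).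
have [cP cY _] := b.
have [x1 y1] := mem _ _ _ s1; have [y2 z2] := mem _ _ _ s2; have [x3 z3] := mem _ _ _ s3.
subst e1 e2 e3.
have [[xP i13]|[xY j13]] := sep _ _ _ _ _ x1 x3;
have [[yP i12]|[yY j12]] := sep _ _ _ _ _ y1 y2;
have [[zP i23]|[zY j23]] := sep _ _ _ _ _ z2 z3.
- by rewrite -i12 in zP; apply: (tri (P i1)); rewrite ?cP.
- by rewrite -i12 i13 j23 eqxx in n23.
- by rewrite i13 -i23 j12 eqxx in n12.
- by rewrite i13 -j23 j12 eqxx in n13.
- by rewrite i12 i23 j13 eqxx in n13.
- by rewrite i12 j13 -j23 eqxx in n12.
- by rewrite i23 -j12 j13 eqxx in n23.
- by rewrite -j12 in zY; apply: (tri (Y j1)); rewrite ?cY.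
Qed.

(** Different edges of a matching contain different [P i], so there are at most [s]; joining [P i]
    to [Y i], possible as [s <= m], attains this. *)
Lemma bigrid_matching_number (T : finType) s m t (P : 'I_s -> {set T})
    (Y : 'I_m -> {set T}) :
  0 < t -> s <= m -> blocks t P Y -> matching_number (bigrid P Y) = s.
Proof.
move=> t0 sm b; apply/eqP; rewrite eqn_leq; apply/andP; split.
  apply/bigmax_leqP => M /andP[ME tM].
  pose h (e : {set T}) := [pick i | P i \subset e].
  have hP e : e \in M -> exists2 i, h e = Some i & P i \subset e.
    move=> eM; rewrite /h; case: pickP => [i si|none]; first by exists i.
    have /bigridP[i [j ee]] := subsetP ME e eM.
    by have := none i; rewrite ee subsetUl.
  rewrite -(card_ord s) -(card_in_imset (f := h) (D := mem M)); last first.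
    move=> e f eM fM; have [i -> ie] := hP e eM; have [k -> kf] := hP f fM.
    case=> ik; apply/eqP/negPn/negP => ef; have [x xi] := block_nonempty b i.
    have := trivIset_disjoint tM eM fM ef => /disjointFr /(_ (subsetP ie x xi)).
    by rewrite (subsetP kf) // -ik.
  rewrite -(card_imset 'I_s (@Some_inj _)); apply: subset_leq_card.
  apply/subsetP => o /imsetP[e eM ->]; have [i -> _] := hP e eM.
  exact: imset_f.
pose w (i : 'I_s) := widen_ord sm i.
pose M := [set P i :|: Y (w i) | i : 'I_s].
have injM : injective (fun i => P i :|: Y (w i)).
  by move=> i k /(bigrid_inj t0 b)[].
have cM : #|M| = s by rewrite card_imset ?card_ord.
apply: (@leq_trans #|M|); first by rewrite cM.
rewrite /matching_number (bigD1 M) /=; first exact: leq_maxl.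
apply/andP; split.
  by apply/subsetP => e /imsetP[i _ ->]; apply/bigridP; exists i, (w i).
apply/trivIsetP => e f /imsetP[i _ ->] /imsetP[k _ ->] ne.
have ik : i <> k by move=> ik; rewrite ik eqxx in ne.
have wik : w i <> w k by move=> /(congr1 val) /= /val_inj.
rewrite disjoint_subset; apply/subsetP => x; rewrite !inE negb_or.
case/orP => xi; apply/andP; split; apply/negP => xk.
- exact: ik (blocksPP b xi xk).
- exact: blocksPY b xi xk.
- exact: blocksPY b xk xi.
- exact: wik (blocksYY b xi xk).
Qed.

(** A point of [B k] goes to the point of [B' k] at the same position of the enumeration. Since
    [#|T| = #|T'|], injectivity is enough. *)
Lemma family_bijection (K T T' : finType) (B : K -> {set T}) (B' : K -> {set T'}) :
  #|T| = #|T'| ->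
  (forall k l x, x \in B k -> x \in B l -> k = l) ->
  (forall k l x, x \in B' k -> x \in B' l -> k = l) ->
  (forall x, exists k, x \in B k) -> (forall k, #|B k| = #|B' k|) ->
  exists2 f : T -> T', bijective f & forall k, f @: B k = B' k.
Proof.
move=> cT dB dB' cov cB.
have /fin_all_exists[f fP] x : exists y : T', exists k,
    [/\ x \in B k, y \in B' k & index x (enum (B k)) = index y (enum (B' k))].
  have [k xk] := cov x.
  have [y0 y0k] : exists y0, y0 \in B' k.
    by apply/card_gt0P; rewrite -cB; apply/card_gt0P; exists x.
  have ix : index x (enum (B k)) < size (enum (B' k)).
    by rewrite -cardE -cB cardE index_mem mem_enum.
  exists (nth y0 (enum (B' k)) (index x (enum (B k)))), k; split=> //.
    by rewrite -mem_enum mem_nth.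
  by rewrite index_uniq ?enum_uniq.
have injf : injective f.
  move=> x x' e; have [k [xk yk ik]] := fP x; have [l [xl yl il]] := fP x'.
  rewrite e in yk ik; have kl := dB' _ _ _ yk yl; subst l.
  rewrite -il in ik; apply: (@index_inj _ x (enum (B k))) ik; by rewrite mem_enum.
exists f; first by apply: inj_card_bij injf _; rewrite cT.
move=> k; apply/eqP; rewrite eqEcard card_imset // cB leqnn andbT.
apply/subsetP => y /imsetP[x xk ->]; have [l [xl yl _]] := fP x.
by rewrite (dB _ _ _ xk xl).
Qed.

Lemma bigrid_isomorphic (T T' : finType) s m t (P : 'I_s -> {set T})
    (Y : 'I_m -> {set T}) (P' : 'I_s -> {set T'}) (Y' : 'I_m -> {set T'}) :
  #|T| = #|T'| -> blocks t P Y -> blocks t P' Y' ->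
  (forall x, exists k, x \in join_fam P Y k) ->
  isomorphic (bigrid P Y) (bigrid P' Y').
Proof.
move=> cT [cP cY d] [cP' cY' d'] cov.
have [|f bf fB] := family_bijection cT d d' cov.
  by case=> [i|j] /=; rewrite ?cP ?cP' ?cY ?cY'.
exists f; split=> //; rewrite /bigrid -imset_comp; apply: eq_imset => -[i j] /=.
by rewrite imsetU (fB (inl i)) (fB (inr j)).
Qed.

(** Determines [m] from [#|T|], so the [Y] blocks found in an extremal graph need no direct
    count. *)
Lemma card_blocks (T : finType) s m t (P : 'I_s -> {set T}) (Y : 'I_m -> {set T}) :
  blocks t P Y -> (forall x, exists k, x \in join_fam P Y k) ->
  #|T| = 2 * s + t * m.
Proof.
move=> [cP cY d] cov.
have -> : #|T| = \sum_(x : T) \sum_(k : 'I_s + 'I_m) (x \in join_fam P Y k).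
  rewrite -sum1_card; apply: eq_bigr => x _; have [k xk] := cov x.
  rewrite (bigD1 k) //= xk big1 ?addn0 // => l lk.
  by apply/eqP; rewrite eqb0; apply: contra lk => xl; rewrite (d _ _ _ xk xl).
rewrite exchange_big /= big_sumType /=.
rewrite (eq_bigr (fun=> 2)) => [|i _]; last first.
  by rewrite -(cP i) -sum1_card [RHS]big_mkcond; apply: eq_bigr => x _; case: (x \in _).
rewrite [X in _ + X](eq_bigr (fun=> t)) => [|j _]; last first.
  by rewrite -(cY j) -sum1_card [RHS]big_mkcond; apply: eq_bigr => x _; case: (x \in _).
by rewrite !sum_nat_const !card_ord mulnC (mulnC m).
Qed.

(** * The constructions as grids of intervals, and their sizes *)

Definition segment (n a t : nat) : {set 'I_n} := [set x : 'I_n | a <= x < a + t].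

Lemma card_segment n a t : a + t <= n -> #|segment n a t| = t.
Proof.
move=> h; have lt (i : 'I_t) : a + i < n by have := ltn_ord i; lia.
have -> : segment n a t = [set Ordinal (lt i) | i : 'I_t].
  apply/setP => x; rewrite inE; apply/idP/imsetP => [hx|[i _ ->]] /=.
    have xi : x - a < t by lia.
    by exists (Ordinal xi) => //; apply: ord_inj => /=; lia.
  by have := ltn_ord i; lia.
rewrite card_imset ?card_ord // => i j /(congr1 val) /= e.
by apply: ord_inj; lia.
Qed.

Lemma segment_blocks n s t m : 0 < t <= 2 -> 2 * s + t * m <= n ->
  blocks t (fun i : 'I_s => segment n (2 * i) 2)
           (fun j : 'I_m => segment n (2 * s + t * j) t).
Proof.
move=> t12 h; split.
- by move=> i; apply: card_segment; have := ltn_ord i; lia.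
- by move=> j; apply: card_segment; have := ltn_ord j; nia.
have t1 : t = 1 \/ t = 2 by lia.
case=> [i|i] [j|j] x /=; rewrite !inE => hi hj.
- by congr inl; apply: ord_inj => /=; lia.
- by have := ltn_ord i; lia.
- by have := ltn_ord j; lia.
- by congr inr; apply: ord_inj => /=; case: t1 => et; move: hi hj; rewrite et; lia.
Qed.

Lemma vset_segments n (l : seq nat) a b t :
  (forall x : nat, (x \in l) = (a <= x < a + 2) || (b <= x < b + t)) ->
  vset n l = segment n a 2 :|: segment n b t.
Proof. by move=> h; apply/setP => x; rewrite !inE h. Qed.

(** The factor in [1 * j] matches the form [t * j] of [segment_blocks]. *)
Lemma H3_bigrid s n :
  H3 s n = bigrid (fun i : 'I_s => segment n (2 * i) 2)
                  (fun j : 'I_(n - 2 * s) => segment n (2 * s + 1 * j) 1).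
Proof.
have eq (i j : nat) : vset n [:: 2 * i; 2 * i + 1; 2 * s + j]
    = segment n (2 * i) 2 :|: segment n (2 * s + 1 * j) 1.
  by apply: vset_segments => x; rewrite !inE; lia.
apply/setP => e; apply/imset2P/bigridP => [[i j _ _ ->]|[i [j ->]]].
  by exists i, j; rewrite eq.
by exists i j; rewrite ?inE // eq.
Qed.

Lemma H4_grid_bigrid s n :
  H4_grid s n = bigrid (fun i : 'I_s => segment n (2 * i) 2)
    (fun j : 'I_((n - 2 * s) %/ 2) => segment n (2 * s + 2 * j) 2).
Proof.
have eq (i j : nat) :
    vset n [:: 2 * i; 2 * i + 1; 2 * s + 2 * j; 2 * s + 2 * j + 1]
    = segment n (2 * i) 2 :|: segment n (2 * s + 2 * j) 2.
  by apply: vset_segments => x; rewrite !inE; lia.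
apply/setP => e; apply/imset2P/bigridP => [[i j _ _ ->]|[i [j ->]]].
  by exists i, j; rewrite eq.
by exists i j; rewrite ?inE // eq.
Qed.

Lemma vset_eq_mem n (l l' : seq nat) a :
  vset n l = vset n l' -> a < n -> (a \in l) = (a \in l').
Proof. by move=> e an; have /setP/(_ (Ordinal an)) := e; rewrite !inE. Qed.

(** Single labels tell the edges apart: [4 * i + 1] and [4 * i + 4] identify the edge with index [i]
    in the first and second family, no edge of the first contains a positive multiple of 4, and
    [4 * k + 1] occurs only in the additional edge. *)
Lemma card_H4_star n :
  0 < n -> #|H4_star n| = 2 * ((n - 1) %/ 4) + (4 %| n).
Proof.
move=> n0; rewrite /H4_star; set k := (n - 1) %/ 4.
have kn : 4 * k < n by rewrite /k; lia.
have kn4 : 4 %| n -> 4 * k + 4 = n by rewrite /k; lia.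
set A := [set _ | i : 'I_k]; set B := [set _ | i : 'I_k]; set C := if _ then _ else _.
have cA : #|A| = k.
  rewrite card_imset ?card_ord // => i j e; apply: ord_inj => /=.
  have := ltn_ord i => ik.
  have := @vset_eq_mem _ _ _ (4 * i + 1) e; rewrite !inE => e1; lia.
have cB : #|B| = k.
  rewrite card_imset ?card_ord // => i j e; apply: ord_inj => /=.
  have := ltn_ord i => ik.
  have := @vset_eq_mem _ _ _ (4 * i + 4) e; rewrite !inE => e1; lia.
have cC : #|C| = (4 %| n) by rewrite /C; case: ifP => _; rewrite ?cards1 ?cards0.
have dAB : [disjoint A & B].
  rewrite disjoint_subset; apply/subsetP => e /imsetP[i _ ->]; rewrite inE.
  apply/negP => /imsetP[j _ ee]; have := ltn_ord j => jk.
  have := @vset_eq_mem _ _ _ (4 * j + 4) ee; rewrite !inE; lia.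
have dABC : [disjoint A :|: B & C].
  rewrite /C; case: ifP => [d|_]; last by rewrite -setI_eq0 setI0.
  rewrite disjoint_sym disjoint_setU -!setI_eq0.
  apply/andP; split; apply/eqP/setP => e; rewrite !inE; apply/negP => /andP[/eqP->].
    case/imsetP => i _ ee; have := ltn_ord i => ik; have := kn4 d => nk.
    have := @vset_eq_mem _ _ _ (4 * k + 1) ee; rewrite !inE; lia.
  case/imsetP => i _ ee; have := ltn_ord i => ik; have := kn4 d => nk.
  have := @vset_eq_mem _ _ _ (4 * k + 1) ee; rewrite !inE; lia.
by rewrite !card_disjoint_setU // cA cB cC mul2n addnn.
Qed.

(** * The case r = 3 *)

Definition slots (V : finType) (M : {set {set V}}) : {set {set V} * V} :=
  [set ec | (ec.1 \in M) && (ec.2 \notin ec.1)].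

(** Degree 1 makes [f] the only edge joining [ec.2] to [ec.1], so different edges own disjoint sets
    of slots. *)
Definition owned (V : finType) (E M : {set {set V}}) (f : {set V}) : {set {set V} * V} :=
  [set ec in slots M | [&& f \in meeting E ec.1, ec.2 \in f
                        & deg (meeting E ec.1) ec.2 == 1]].

Definition slot_weight (V : finType) (M : {set {set V}}) (c : V) : nat :=
  if c \in cover M then 1 else 3.

Definition weight (V : finType) (E M : {set {set V}}) (f : {set V}) : nat :=
  \sum_(ec in owned E M f) slot_weight M ec.2.

Lemma slot_weight_gt0 (V : finType) (M : {set {set V}}) c : 0 < slot_weight M c.
Proof. by rewrite /slot_weight; case: ifP. Qed.

Lemma ownedI (V : finType) (E M : {set {set V}}) (e f : {set V}) c :
  e \in M -> c \notin e -> f \in meeting E e -> c \in f ->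
  deg (meeting E e) c = 1 -> (e, c) \in owned E M f.
Proof. by move=> eM ce fX cf d; rewrite inE /= fX cf d eqxx inE /= eM ce. Qed.

Lemma weight_outside (V : finType) (E M : {set {set V}}) (f e : {set V}) c :
  (e, c) \in owned E M f -> c \notin cover M -> 2 + #|owned E M f| <= weight E M f.
Proof.
move=> ec cM; rewrite /weight (bigD1 (e, c)) //= {1}/slot_weight (negPf cM).
rewrite (cardD1 (e, c)) ec addnA leq_add2l -sum1_card.
rewrite (eq_bigl (fun i => (i \in owned E M f) && (i != (e, c)))) => [|i].
  by apply: leq_sum => i _; apply: slot_weight_gt0.
by rewrite inE /= andbC.
Qed.

Lemma weight_card (V : finType) (E M : {set {set V}}) (f : {set V}) :
  #|owned E M f| <= weight E M f.
Proof. by rewrite -sum1_card; apply: leq_sum => i _; apply: slot_weight_gt0. Qed.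

Lemma sum_weight (V : finType) (E M : {set {set V}}) :
  \sum_(f in E) weight E M f
  = \sum_(ec in slots M) (deg (meeting E ec.1) ec.2 == 1) * slot_weight M ec.2.
Proof.
rewrite (exchange_big_dep (mem (slots M))) /=; last first.
  by move=> f ec _; rewrite inE => /andP[].
apply: eq_bigr => -[e c] /= ecS; rewrite sum_nat_cond_const; congr (_ * _).
have [d1|d1] := eqVneq (deg (meeting E e) c) 1; last first.
  by apply: eq_card0 => f; rewrite !inE /= (negPf d1) !andbF.
rewrite -[RHS]d1; apply: eq_card => f; move: ecS.
by rewrite !inE /= d1 eqxx andbT => ->; case: (f \in E).
Qed.

(** If [f] joins [a] in [e] to [y] in [e'] and owns [(e, y)], it also owns [(e', a)]: another edge
    from [a] to [e'] would meet [e'] in [y] by [trace_eq], and so be a second edge joining [y] to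
    [e]. *)
Lemma slot_sym (V : finType) (E : {set {set V}}) (e e' f : {set V}) a y :
  berge_triangle_free E -> e' \in E -> f \in E -> a \in f -> a \in e -> y \in f ->
  y \in e' -> a \notin e' -> deg (meeting E e) y = 1 -> deg (meeting E e') a = 1.
Proof.
move=> fr e'E fE af ae yf ye' ae' d.
have fX' : f \in meeting E e' by apply/meetingP; split=> //; exists y.
have fX : f \in meeting E e by apply/meetingP; split=> //; exists a.
apply: (deg_eq1 fX' af) => g gX' ag; apply/eqP/negPn/negP => gf.
have [gE [x xg xe']] := meetingP _ _ _ gX'.
have xy := trace_eq fr e'E fE gE gf af ag ae' yf ye' xg xe'.
have gX : g \in meeting E e by apply/meetingP; split=> //; exists a.
move/eqP/cards1P: d => [h hh].
have : f \in [set f in meeting E e | y \in f] by rewrite inE fX yf.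
have : g \in [set f in meeting E e | y \in f] by rewrite inE gX -xy xg.
by rewrite hh !inE => /eqP gh /eqP fh; rewrite gh fh eqxx in gf.
Qed.

Lemma sub3_eq (T : finType) (A B : {set T}) : #|A| = 3 -> #|B| = 3 ->
  A \subset B -> A = B.
Proof. by move=> cA cB s; apply/eqP; rewrite eqEcard s cA cB. Qed.

Lemma small_trace_third (T : finType) (f e : {set T}) a : #|f| = 3 ->
  #|f :&: e| <= 1 -> a \in f -> a \in e ->
  exists y z, [/\ y \in f, z \in f, y \notin e, z \notin e &
    [/\ a != y, a != z, y != z & f = [set a; y; z]]].
Proof.
move=> cf c1 af ae.
have c2 : #|f :\ a| = 2 by move: (cardsD1 a f); rewrite af cf => -[].
move/eqP/cards2P: (c2) => [y [z [yz eq]]].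
have : y \in f :\ a by rewrite eq !inE eqxx.
have : z \in f :\ a by rewrite eq !inE eqxx orbT.
rewrite !inE => /andP[za zf] /andP[ya yf].
have out x : x \in f -> x != a -> x \notin e.
  move=> xf xa; apply/negP => xe; move: c1; rewrite leqNgt => /negP; apply.
  by apply/card_gt1P; exists a, x; rewrite !inE af ae xf xe eq_sym.
exists y, z; split; rewrite ?out //; split; rewrite // 1?eq_sym //.
by rewrite -(setD1K af) eq setUA.
Qed.

(** If both degrees differ from 1, [heavy_pair] gives a second edge through [a], [y] and [z], which
    are all of [f]. *)
Lemma light_or (V : finType) (E : {set {set V}}) (e f : {set V}) a y z :
  uniform 3 E -> berge_triangle_free E -> e \in E -> f \in meeting E e ->
  a \in f -> a \in e -> y \in f -> z \in f -> y \notin e -> z \notin e ->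
  y != z -> f = [set a; y; z] ->
  deg (meeting E e) y = 1 \/ deg (meeting E e) z = 1.
Proof.
move=> un fr eE fX af ae yf zf ye ze yz def.
have [|dy] := eqVneq (deg (meeting E e) y) 1; first by left.
have [|dz] := eqVneq (deg (meeting E e) z) 1; first by right.
have [g [gX gf [ag yg zg] _]] :=
  heavy_pair fr eE (subxx _) fX af ae yf zf ye ze yz dy dz.
have [fE _] := meetingP _ _ _ fX; have [gE _] := meetingP _ _ _ gX.
case/eqP: gf; apply/esym/sub3_eq; rewrite ?un //.
by rewrite def; apply/subsetP => x; rewrite !inE => /orP[/orP[]|] /eqP->.
Qed.

Lemma mem_meetingI (V : finType) (E : {set {set V}}) (e f : {set V}) x :
  f \in E -> x \in f -> x \in e -> f \in meeting E e.
Proof. by move=> fE xf xe; apply/meetingP; split=> //; exists x. Qed.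

(** One owned slot at an uncovered vertex suffices ([one]), and so do three owned slots of any kind
    ([three]). The cases are whether [f] meets some matching edge twice and, if not, which of its
    vertices are covered. *)
Lemma weight_ge3 (V : finType) (E M : {set {set V}}) (f : {set V}) :
  uniform 3 E -> berge_triangle_free E -> max_matching E M -> f \in E -> f \notin M ->
  3 <= weight E M f.
Proof.
move=> un fr mM fE fM; have [ME tM _] := mM.
have inE3 e : e \in M -> e \in E by apply: (subsetP ME).
have dM := trivIset_disjoint tM.
have fnM e : e \in M -> f != e by apply: contraTneq => <-.
have out (x : V) (e : {set V}) : x \in e -> e \in M -> forall e', e' \in M -> e' != e -> x \notin e'.
  by move=> xe eM e' e'M n; rewrite (disjointFl (dM e' e e'M eM n) xe).
have cov (x : V) : x \in cover M -> exists2 e, e \in M & x \in e by move/bigcupP.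
have three e1 c1 e2 c2 e3 c3 : (e1, c1) \in owned E M f -> (e2, c2) \in owned E M f ->
    (e3, c3) \in owned E M f -> (e1, c1) != (e2, c2) -> (e2, c2) != (e3, c3) ->
    (e3, c3) != (e1, c1) -> 3 <= weight E M f.
  move=> h1 h2 h3 n1 n2 n3; apply: leq_trans (weight_card E M f); apply/card_gt2P.
  by exists (e1, c1), (e2, c2), (e3, c3).
have one e c : (e, c) \in owned E M f -> c \notin cover M -> 3 <= weight E M f.
  move=> ec cM; apply: leq_trans (weight_outside ec cM).
  by rewrite -[3]/(2 + 1) leq_add2l; apply/card_gt0P; exists (e, c).
have [/exists_inP[e eM c2]|none] := boolP [exists e in M, 1 < #|f :&: e|].
  have eE := inE3 e eM.
  have [c cf ce] : exists2 c, c \in f & c \notin e.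
    have /card_gt0P[c] : 0 < #|f :\: e|.
      rewrite card_gt0 setD_eq0; apply/negP => s.
      by move: (fnM e eM); rewrite (sub3_eq _ _ s) ?un // eqxx.
    by rewrite inE => /andP[]; exists c.
  move/card_gt1P: (c2) => [a [b [/setIP[af ae] /setIP[bf be] ab]]].
  have fX : f \in meeting E e := mem_meetingI fE af ae.
  have d : deg (meeting E e) c = 1.
    apply: (deg_eq1 fX cf) => g gX cg.
    by apply: (@trace2_unique _ E e f g c); rewrite ?fnM.
  (* If [c] lies in another matching edge [e'], then [slot_sym] derives from this slot the slots
     [(e', a)] and [(e', b)]. *)
  have s1 := ownedI eM ce fX cf d.
  have [/cov[e' e'M ce']|cM] := boolP (c \in cover M); last exact: one s1 cM.
  have nee : e' != e by apply: contraNneq ce => <-.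
  have fX' := mem_meetingI fE cf ce'.
  have ae' := out a e ae eM e' e'M nee; have be' := out b e be eM e' e'M nee.
  have sa := ownedI e'M ae' fX' af (slot_sym fr (inE3 _ e'M) fE af ae cf ce' ae' d).
  have sb := ownedI e'M be' fX' bf (slot_sym fr (inE3 _ e'M) fE bf be cf ce' be' d).
  apply: (three _ _ _ _ _ _ s1 sa sb); rewrite xpair_eqE negb_and.
  - by rewrite eq_sym nee.
  - by rewrite ab orbT.
  - by rewrite nee.
have small e : e \in M -> #|f :&: e| <= 1.
  by move=> eM; rewrite leqNgt; apply: contra none => c2; apply/exists_inP; exists e.
have [e eM /card_meet_gt0[a af ae]] := matching_meets (isT : 0 < 3) un mM fE.
have eE := inE3 e eM; have fX := mem_meetingI fE af ae.
have [y [z [yf zf ye ze [ay az yz def]]]] := small_trace_third (un f fE) (small e eM) af ae.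
have trip (h : {set V}) : a \in h -> y \in h -> z \in h -> h \in E -> h = f.
  move=> ah yh zh hE; apply/esym/sub3_eq; rewrite ?un //.
  by rewrite def; apply/subsetP => x; rewrite !inE => /orP[/orP[]|] /eqP->.
(* Here [a] is in [e], [v] in [e'], and [u] is uncovered. If [f] owns neither [(e, u)] nor
   [(e', u)], a second edge joins [u] to [a] and another joins [u] to [v], and they form a triangle
   with [f]. *)
have mixed (u v : V) (e' : {set V}) : u \in f -> v \in f -> u \notin e -> v \notin e -> u != v ->
    f = [set a; v; u] -> u \notin cover M -> v \in e' -> e' \in M -> e' != e ->
    3 <= weight E M f.
  move=> uf vf ue ve uv def' uM ve' e'M nee.
  have fX' := mem_meetingI fE vf ve'.
  have ue' : u \notin e' by apply: contra uM => h; apply/bigcupP; exists e'.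
  have ae' := out a e ae eM e' e'M nee.
  have [du|du] := eqVneq (deg (meeting E e) u) 1.
    exact: one (ownedI eM ue fX uf du) uM.
  have [du'|du'] := eqVneq (deg (meeting E e') u) 1.
    exact: one (ownedI e'M ue' fX' uf du') uM.
  have [g [gX ug gf]] := deg_neq1 fX uf du; have [gE [x xg xe]] := meetingP _ _ _ gX.
  have [h [hX uh hf]] := deg_neq1 fX' uf du'; have [hE [x' xh xe']] := meetingP _ _ _ hX.
  have xa := trace_eq fr eE fE gE gf uf ug ue af ae xg xe.
  have xv := trace_eq fr (inE3 _ e'M) fE hE hf uf uh ue' vf ve' xh xe'.
  rewrite xa in xg; rewrite xv in xh.
  have gh : g != h.
    apply: contraNneq gf => gh; rewrite -gh in xh; apply/eqP/esym/sub3_eq; rewrite ?un //.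
    by rewrite def'; apply/subsetP => w; rewrite !inE => /orP[/orP[]|] /eqP->.
  case: (@triangle_absurd _ E f h g a v u) => //; rewrite 1?eq_sym //.
  - by apply: contraNneq ve => ->.
  - by apply: contraNneq ue => ->.
have [/cov[e' e'M ye']|yM] := boolP (y \in cover M); last first.
  have [/cov[e' e'M ze']|zM] := boolP (z \in cover M).
    have n' : e' != e by apply: contraNneq ze => <-.
    by apply: (mixed y z e') => //; rewrite def setUAC.
  have [d|d] := light_or un fr eE fX af ae yf zf ye ze yz def.
    exact: one (ownedI eM ye fX yf d) yM.
  exact: one (ownedI eM ze fX zf d) zM.
have n' : e' != e by apply: contraNneq ye => <-.
have [/cov[e'' e''M ze'']|zM] := boolP (z \in cover M); last first.
  by apply: (mixed z y e'); rewrite // eq_sym.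
have n'' : e'' != e by apply: contraNneq ze => <-.
have n3 : e'' != e'.
  apply: contraTneq (small e' e'M) => ee; rewrite -ltnNge; apply/card_gt1P.
  by exists y, z; rewrite !inE yf ye' zf -ee ze''.
have ae' := out a e ae eM e' e'M n'; have ae'' := out a e ae eM e'' e''M n''.
have ye'' := out y e' ye' e'M e'' e''M n3.
have ze' : z \notin e' by apply: (out z e'' ze''); rewrite // eq_sym.
have e'E := inE3 _ e'M; have e''E := inE3 _ e''M.
have fX' := mem_meetingI fE yf ye'; have fX'' := mem_meetingI fE zf ze''.
(* The vertices lie in three different matching edges. [light_or] at [e] gives a slot, [slot_sym]
   its mirror image, and [light_or] at the remaining matching edge a third one. *)
have [d|d] := light_or un fr eE fX af ae yf zf ye ze yz def.
  have s1 := ownedI eM ye fX yf d.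
  have s2 := ownedI e'M ae' fX' af (slot_sym fr e'E fE af ae yf ye' ae' d).
  have def'' : f = [set z; a; y] by rewrite def setUC setUA.
  have [d'|d'] := light_or un fr e''E fX'' zf ze'' af yf ae'' ye'' ay def''.
    have s3 := ownedI e''M ae'' fX'' af d'.
    apply: (three _ _ _ _ _ _ s1 s2 s3); rewrite xpair_eqE negb_and ?n3 ?n'' //.
      by rewrite eq_sym n'.
    by rewrite eq_sym n3.
  have s3 := ownedI e''M ye'' fX'' yf d'.
  apply: (three _ _ _ _ _ _ s1 s2 s3); rewrite xpair_eqE negb_and ?n3 ?n'' //.
    by rewrite eq_sym n'.
  by rewrite eq_sym n3.
have s1 := ownedI eM ze fX zf d.
have s2 := ownedI e''M ae'' fX'' af (slot_sym fr e''E fE af ae zf ze'' ae'' d).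
have def' : f = [set y; a; z] by rewrite def setUAC setUC setUA setUAC.
have [d'|d'] := light_or un fr e'E fX' yf ye' af zf ae' ze' az def'.
  have s3 := ownedI e'M ae' fX' af d'.
  apply: (three _ _ _ _ _ _ s1 s2 s3); rewrite xpair_eqE negb_and ?n3 ?n' //.
  by rewrite eq_sym n''.
have s3 := ownedI e'M ze' fX' zf d'.
apply: (three _ _ _ _ _ _ s1 s2 s3); rewrite xpair_eqE negb_and ?n3 ?n' //.
by rewrite eq_sym n''.
Qed.

Lemma card_cover_matching (V : finType) r (E M : {set {set V}}) :
  uniform r E -> M \subset E -> trivIset M -> #|cover M| = r * #|M|.
Proof.
move=> un ME /eqP <-; rewrite mulnC -sum_nat_const; apply: eq_bigr => e eM.
by rewrite un // (subsetP ME).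
Qed.

(** Each [e] in [M] has [3 * (|M| - 1)] slots of weight 1 and [|V| - 3 * |M|] of weight 3. *)
Lemma sum_slot_weight (V : finType) (E M : {set {set V}}) :
  uniform 3 E -> M \subset E -> trivIset M ->
  \sum_(ec in slots M) slot_weight M ec.2 = 3 * (#|M| * (#|V| - 2 * #|M| - 1)).
Proof.
move=> un ME tM; have cc := card_cover_matching un ME tM.
have cV : #|cover M| + #|~: cover M| = #|V| by rewrite cardsC.
transitivity (\sum_(e in M) \sum_(c | c \notin e) slot_weight M c).
  rewrite pair_big_dep /=; apply: eq_bigl => -[e c]; by rewrite inE.
rewrite (eq_bigr (fun=> 3 * (#|V| - 2 * #|M| - 1))) => [|e eM].
  by rewrite sum_nat_const mulnCA.
have ce : #|e| = 3 by rewrite un // (subsetP ME).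
have eC : e \subset cover M by apply: bigcup_sup.
rewrite (bigID (mem (cover M))) /=.
rewrite (eq_bigr (fun=> 1)) => [|c /andP[_ cM]]; last by rewrite /slot_weight cM.
rewrite [X in _ + X](eq_bigr (fun=> 3)) => [|c /andP[_ cM]]; last first.
  by rewrite /slot_weight (negPf cM).
rewrite !sum_nat_cond_const.
have -> : [set x | (x \notin e) && (x \in cover M)] = cover M :\: e.
  by apply/setP => x; rewrite !inE.
have -> : [set x | (x \notin e) && (x \notin cover M)] = ~: cover M.
  apply/setP => x; rewrite !inE andb_idl //; apply: contra; exact: (subsetP eC).
have M0 : 0 < #|M| by apply/card_gt0P; exists e.
have ar c u n m : c = 3 * m -> c + u = n -> 0 < m ->
    (c - 3) * 1 + u * 3 = 3 * (n - 2 * m - 1) by clear; lia.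
by rewrite cardsD (setIidPr eC) ce; apply: ar cc cV M0.
Qed.

Lemma sum_weight_ge (V : finType) (E M : {set {set V}}) :
  uniform 3 E -> berge_triangle_free E -> max_matching E M ->
  3 * (#|E| - #|M|) <= \sum_(f in E :\: M) weight E M f <= \sum_(f in E) weight E M f.
Proof.
move=> un fr mM; have [ME _ _] := mM.
have -> : #|E| - #|M| = #|E :\: M| by rewrite cardsD (setIidPr ME).
apply/andP; split.
  rewrite mulnC -sum_nat_const; apply: leq_sum => f; rewrite inE => /andP[fM fE].
  exact: weight_ge3.
rewrite [X in _ <= X](big_setID M) /= leq_addl //.
Qed.

Lemma sum_weight_le (V : finType) (E M : {set {set V}}) :
  \sum_(f in E) weight E M f <= \sum_(ec in slots M) slot_weight M ec.2.
Proof.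
rewrite sum_weight; apply: leq_sum => ec _.
by rewrite -[X in _ <= X]mul1n leq_mul2r leq_b1 orbT.
Qed.

Lemma upper3 (V : finType) (E M : {set {set V}}) :
  uniform 3 E -> berge_triangle_free E -> max_matching E M ->
  #|E| <= #|M| * (#|V| - 2 * #|M|).
Proof.
move=> un fr mM; have [ME tM _] := mM.
have /andP[h1 h2] := sum_weight_ge un fr mM; have h3 := sum_weight_le E M.
rewrite (sum_slot_weight un ME tM) in h3.
have := leq_trans h1 (leq_trans h2 h3); rewrite leq_mul2l /=.
have cV : 3 * #|M| <= #|V|.
  by rewrite -cardsT; apply: (card_matching_le un) => // f _; apply: subsetT.
have [->|M0] := posnP #|M|; first by rewrite !mul0n subn0.
rewrite leq_subLR => /leq_trans; apply.
have {}cV : 1 <= #|V| - 2 * #|M| by move: cV M0; clear; lia.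
by rewrite -{1}[#|M|]muln1 -mulnDr subnKC.
Qed.

(** Equality makes the whole chain of weight estimates tight, termwise by [sum_le_eq]. *)
Lemma extremal3_tight (V : finType) (E M : {set {set V}}) :
  uniform 3 E -> berge_triangle_free E -> max_matching E M ->
  #|E| = #|M| * (#|V| - 2 * #|M|) ->
  (forall e c, e \in M -> c \notin e -> deg (meeting E e) c = 1) /\
  (forall f, f \in E -> f \notin M -> weight E M f = 3).
Proof.
move=> un fr mM cE; have [ME tM _] := mM.
have /andP[h1 h2] := sum_weight_ge un fr mM; have h3 := sum_weight_le E M.
have cD : #|E| - #|M| = #|E :\: M| by rewrite cardsD (setIidPr ME).
have eq : 3 * (#|E| - #|M|) = \sum_(ec in slots M) slot_weight M ec.2.
  by rewrite (sum_slot_weight un ME tM) cE [in RHS]mulnBr muln1.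
have le1 : \sum_(ec in slots M) slot_weight M ec.2 <= \sum_(f in E) weight E M f.
  by rewrite -eq; apply: leq_trans h2.
split.
  move=> e c eM ce; have ecS : (e, c) \in slots M by rewrite inE /= eM ce.
  rewrite sum_weight in le1.
  have := @sum_le_eq _ (slots M)
    (fun ec => (deg (meeting E ec.1) ec.2 == 1) * slot_weight M ec.2)
    (fun ec => slot_weight M ec.2) _ le1 _ ecS.
  move=> /= H; have {}H : (deg (meeting E e) c == 1) * slot_weight M c = slot_weight M c.
    by apply: H => ec _; rewrite -[X in _ <= X]mul1n leq_mul2r leq_b1 orbT.
  by case: eqP H (slot_weight_gt0 M c) => // _ <-.
move=> f fE fM; apply/esym.
apply: (@sum_le_eq _ (E :\: M) (fun=> 3) (weight E M)).
- by move=> g; rewrite inE => /andP[gM gE]; apply: weight_ge3.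
- by rewrite sum_nat_const mulnC -cD eq; apply: leq_trans h2 h3.
by rewrite inE fM.
Qed.

(** Otherwise [f] meets every matching edge at most once and owns both [(e, y)] and [(e, z)]. If [y]
    is uncovered, this already weighs at least 4; if [y] lies in [e'], then [(e', a)] and [(e', z)]
    make four slots. Either way the weight exceeds 3. *)
Lemma extremal3_trace (V : finType) (E M : {set {set V}}) (f : {set V}) :
  uniform 3 E -> berge_triangle_free E -> max_matching E M ->
  #|E| = #|M| * (#|V| - 2 * #|M|) -> f \in E -> f \notin M ->
  exists2 e, e \in M & 1 < #|f :&: e|.
Proof.
move=> un fr mM cE fE fM; have [ME tM _] := mM.
have [own w3] := extremal3_tight un fr mM cE; have w := w3 f fE fM.
apply/exists_inP; apply: contraT => none.
have small e : e \in M -> #|f :&: e| <= 1.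
  by move=> eM; rewrite leqNgt; apply: contra none => c2; apply/exists_inP; exists e.
have [e eM /card_meet_gt0[a af ae]] := matching_meets (isT : 0 < 3) un mM fE.
have fX := mem_meetingI fE af ae.
have [y [z [yf zf ye ze [ay az yz def]]]] := small_trace_third (un f fE) (small e eM) af ae.
have sy := ownedI eM ye fX yf (own e y eM ye).
have sz := ownedI eM ze fX zf (own e z eM ze).
have yz' : (e, y) != (e, z) by rewrite xpair_eqE negb_and yz orbT.
have two : 2 <= #|owned E M f| by apply/card_gt1P; exists (e, y), (e, z).
have [/bigcupP[e' e'M ye']|yM] := boolP (y \in cover M); last first.
  by have := weight_outside sy yM; rewrite w -[3]/(2 + 1) leq_add2l leqNgt two.
have nee : e' != e by apply: contraNneq ye => <-.
have fX' := mem_meetingI fE yf ye'.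
have ae' : a \notin e' by rewrite (disjointFl (trivIset_disjoint tM e'M eM nee) ae).
have ze' : z \notin e'.
  apply/negP => ze'; move: (small e' e'M); rewrite leqNgt => /negP; apply.
  by apply/card_gt1P; exists y, z; rewrite !inE yf zf ye' ze'.
have sa' := ownedI e'M ae' fX' af (own e' a e'M ae').
have sz' := ownedI e'M ze' fX' zf (own e' z e'M ze').
have az' : (e', a) != (e', z) by rewrite xpair_eqE negb_and az orbT.
have sub : [set (e, y); (e, z)] :|: [set (e', a); (e', z)] \subset owned E M f.
  by rewrite !subUset !sub1set sy sz sa' sz'.
have c4 : #|[set (e, y); (e, z)] :|: [set (e', a); (e', z)]| = 4.
  rewrite card_disjoint_setU ?cards2 ?yz' ?az' //.
  rewrite disjoint_subset; apply/subsetP => -[u v].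
  by rewrite !inE !xpair_eqE => /orP[] /andP[/eqP-> _]; rewrite !(eq_sym e) (negPf nee).
by have := leq_trans (subset_leq_card sub) (weight_card E M f); rewrite w c4.
Qed.

(** By [trace_share], all edges meeting a given [e] in two vertices do so in one pair [p e], as two
    pairs in a triple intersect. With [U] the vertices outside these pairs, every [p e :|: [set y]]
    with [y] in [U] is an edge, and there are already [|E|] of these. *)
Lemma extremal3_bigrid (V : finType) (E M : {set {set V}}) :
  uniform 3 E -> berge_triangle_free E -> max_matching E M ->
  #|E| = #|M| * (#|V| - 2 * #|M|) ->
  exists m, exists P : 'I_#|M| -> {set V}, exists Y : 'I_m -> {set V},
  [/\ m = #|V| - 2 * #|M|, blocks 1 P Y,
      forall x, exists k, x \in join_fam P Y k & E = bigrid P Y].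
Proof.
move=> un fr mM cE; have [ME tM _] := mM; have dM := trivIset_disjoint tM.
have inE3 e : e \in M -> e \in E by apply: (subsetP ME).
have [own _] := extremal3_tight un fr mM cE.
have trE := extremal3_trace un fr mM cE.
have le2 e f : e \in M -> f \in E -> f != e -> #|f :&: e| <= 2.
  move=> eM fE; rewrite leqNgt; apply: contra => c3.
  have fe : f \subset e by apply/setIidPl/eqP; rewrite eqEcard subsetIl (un f fE).
  by rewrite (sub3_eq (un f fE) (un e (inE3 e eM)) fe).
(* If no other edge meets [e] in two vertices, any pair in [e] serves; [set0] is a default for [e]
   outside [M]. *)
have pex e : exists p : {set V}, e \in M -> [/\ #|p| = 2, p \subset e &
    forall f, f \in E -> f != e -> 1 < #|f :&: e| -> f :&: e = p].
  have [eM|//] := boolP (e \in M); last by exists set0.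
  have eE := inE3 e eM.
  have [/existsP[g /and3P[gE ge cg]]|none] :=
    boolP [exists g : {set V}, [&& g \in E, g != e & 1 < #|g :&: e|]].
    have cg2 : #|g :&: e| = 2 by apply/eqP; rewrite eqn_leq le2.
    exists (g :&: e) => _; split=> //; first exact: subsetIr.
    move=> f fE fe cf; have cf2 : #|f :&: e| = 2 by apply/eqP; rewrite eqn_leq le2.
    have [x /setIP[/setIP[xf xe] /setIP[xg _]]] : exists x, x \in (f :&: e) :&: (g :&: e).
      apply/card_gt0P; move: (cardsUI (f :&: e) (g :&: e)); rewrite cf2 cg2.
      have : #|(f :&: e) :|: (g :&: e)| <= 3.
        by rewrite -(un e eE); apply: subset_leq_card; rewrite subUset !subsetIr.
      by clear; lia.
    exact: (trace_share fr eE fE gE fe ge cf2 cg2 xf xg xe).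
  have /card_gt0P[x xe] : 0 < #|e| by rewrite un.
  exists (e :\ x) => _; split; last 1 first.
  - move=> f fE fe cf; case/negP: none; apply/existsP; exists f.
    by rewrite fE fe cf.
  - by move: (cardsD1 x e); rewrite xe un // => -[].
  exact: subsetDl.
have [p pP] := fin_all_exists pex.
have cp e : e \in M -> #|p e| = 2 by move=> /pP[].
have pe e : e \in M -> p e \subset e by move=> /pP[].
have tp e f : e \in M -> f \in E -> f != e -> 1 < #|f :&: e| -> f :&: e = p e.
  by move=> /pP[_ _]; apply.
pose U := ~: \bigcup_(e in M) p e.
have full e f y : e \in M -> f \in E -> p e \subset f -> y \in f -> y \notin e ->
    p e :|: [set y] = f.
  move=> eM fE pf yf ye; apply/eqP; rewrite eqEcard subUset pf sub1set yf un //=.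
  rewrite card_disjoint_setU ?cp ?cards1 // disjoint_sym disjoints1.
  by apply: contra ye; apply: (subsetP (pe e eM)).
have core e y : e \in M -> y \in U -> p e :|: [set y] \in E.
  move=> eM yU; have eE := inE3 e eM.
  have yp e' : e' \in M -> y \notin p e'.
    by move=> e'M; move: yU; rewrite inE; apply: contra => yp; apply/bigcupP; exists e'.
  have [ye|ye] := boolP (y \in e).
    have <- // : e = p e :|: [set y].
    apply/esym/eqP; rewrite eqEcard subUset pe // sub1set ye un //=.
    rewrite card_disjoint_setU ?cp ?cards1 // disjoint_sym disjoints1.
    exact: yp.
  (* The edge [f] joining [y] to [e] meets some matching edge [e'] in [p e']. If [e'] is not [e],
     this pair together with [a] and [y] makes four vertices in [f]. *)
  have /eqP/cards1P[f hf] := own e y eM ye.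
  have : f \in [set f in meeting E e | y \in f] by rewrite hf inE.
  rewrite inE => /andP[fX yf]; have [fE [a af ae]] := meetingP _ _ _ fX.
  have fM : f \notin M.
    apply/negP => fM; have [fe|fe] := eqVneq f e; first by rewrite -fe yf in ye.
    by rewrite (disjointFl (dM _ _ fM eM fe) ae) in af.
  have fne e' : e' \in M -> f != e' by apply: contraTneq => <-.
  have [e' e'M c2] := trE f fE fM.
  have te' := tp e' f e'M fE (fne e' e'M) c2.
  have [ee|ne] := eqVneq e' e.
    rewrite (full e f) //; by rewrite -ee -te' subsetIl.
  have ye' : y \notin e'.
    by apply: contra (yp e' e'M) => ye'; rewrite -te' inE yf.
  have ae' : a \notin e' by rewrite (disjointFl (dM _ _ e'M eM ne) ae).
  have : #|[set a; y] :|: (f :&: e')| <= 3.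
    rewrite -(un f fE); apply: subset_leq_card; rewrite !subUset subsetIl !sub1set.
    by rewrite af yf.
  have ay : a != y by apply: contraNneq ye => <-.
  rewrite card_disjoint_setU; last first.
    rewrite disjoint_subset; apply/subsetP => x; rewrite !inE negb_and.
    by case/orP => /eqP->; rewrite ?ae' ?ye' orbT.
  by rewrite cards2 ay leqNgt => /negP[]; apply: (@leq_add 2 2 2).
pose P (i : 'I_#|M|) := p (enum_val i).
pose Y (j : 'I_#|U|) := [set enum_val j].
have PM (i : 'I_#|M|) : enum_val i \in M := enum_valP i.
have notU e x : e \in M -> x \in p e -> x \notin U.
  by move=> eM xp; rewrite inE negbK; apply/bigcupP; exists e.
have bl : blocks 1 P Y.
  split.
  - by move=> i; apply: cp; apply: PM.
  - by move=> j; rewrite cards1.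
  case=> [i|i] [j|j] x /= xi xj.
  - congr inl; apply/enum_val_inj/eqP/negPn/negP => n.
    have := disjointFr (dM _ _ (PM i) (PM j) n) (subsetP (pe _ (PM i)) x xi).
    by rewrite (subsetP (pe _ (PM j)) x xj).
  - have := notU _ x (PM i) xi; move: xj; rewrite inE => /eqP->.
    by rewrite enum_valP.
  - have := notU _ x (PM j) xj; move: xi; rewrite inE => /eqP->.
    by rewrite enum_valP.
  - by congr inr; apply: enum_val_inj; move: xi xj; rewrite !inE => /eqP<- /eqP.
have cov x : exists k, x \in join_fam P Y k.
  have [xU|] := boolP (x \in U).
    by exists (inr (enum_rank_in xU x)); rewrite /= /Y enum_rankK_in // inE.
  rewrite inE negbK => /bigcupP[e eM xp].
  by exists (inl (enum_rank_in eM e)); rewrite /= /P enum_rankK_in.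
have cm : #|U| = #|V| - 2 * #|M|.
  by rewrite (card_blocks bl cov) addnC addnK mul1n.
exists #|U|, P, Y; split=> //.
have cG : #|bigrid P Y| = #|E| by rewrite (card_bigrid _ bl) // cE cm.
apply/esym/eqP; rewrite eqEcard cG leqnn andbT.
apply/subsetP => g /bigridP[i [j ->]]; apply: core; first exact: PM.
exact: enum_valP.
Qed.

(** * Extremal 4-graphs *)

Definition extremal4 (V : finType) (E M : {set {set V}}) (W : {set V}) : Prop :=
  [/\ uniform 4 E, berge_triangle_free E, forall f, f \in E -> f \subset W,
      max_matching E M &
      ~~ odd #|W| /\ #|E| = #|M| * ((#|W| - 2 * #|M|) %/ 2)].

(** For even [|W|] no edge is exceptional, so the edges meeting [e] and those avoiding it are
    bounded by the two terms of [upper4_arith2], and both bounds must be attained. *)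
Lemma extremal4_split (V : finType) (E M : {set {set V}}) (W e : {set V}) :
  extremal4 E M W -> e \in M ->
  2 * #|meeting E e| + 2 = #|W| /\ (1 < #|M| -> extremal4 (away E e) (M :\ e) (W :\: e)).
Proof.
case=> un fr EW mM [ev cE] eM; have [ME tM _] := mM.
have eE := subsetP ME e eM.
have up : 2 * #|meeting E e| <= #|W| - 2.
  by move: (meeting_card un fr eE) (card_outer_le un EW eE) ev; clear; lia.
have cW : 4 * #|M| <= #|W| by apply: (card_matching_le un EW).
have un0 := uniformS (away_sub E e) un; have fr0 := btfS (away_sub E e) fr.
have EW0 := away_sub_W (e := e) EW.
have cW0 : #|W :\: e| = #|W| - 4.
  by move: (cardsID e W); rewrite (setIidPr (EW e eE)) (un e eE); clear; lia.
have mM0 := max_matching_away (isT : 0 < 4) un mM eM.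
have cM0 := card_setD1_matching eM.
have M0 : 0 < #|M| by apply/card_gt0P; exists e.
have [M1|M1] := eqVneq #|M| 1.
  split; last by rewrite M1.
  rewrite (matching1_star _ un mM M1 eM) // cE M1.
  by move: cW ev; rewrite M1; clear; lia.
have {}M1 : 1 < #|M| by move: M0 M1; clear; lia.
have up0 : #|away E e| <= (#|M| - 1) * ((#|W| - 4 - 2 * (#|M| - 1)) %/ 2).
  have [M2|M2] := eqVneq #|M| 2.
    have M01 : #|M :\ e| = 1 by rewrite cM0 M2.
    have [u _] := upper4_star un0 fr0 EW0 mM0 M01.
    by move: u cW ev; rewrite cW0 M2; clear; lia.
  rewrite -cW0 -cM0; apply: (upper4 un0 fr0 EW0 mM0) => //.
  by rewrite cM0; move: M1 M2; clear; lia.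
have ar := upper4_arith2 M1 cW; rewrite -cE in ar.
have cEE := card_meeting_away E e.
split.
  by move: up up0 ar cEE ev cW M1; move: (_ * (_ %/ 2)); clear; lia.
move=> _; split=> //; rewrite cW0 cM0; split.
  by move: ev cW M1; clear; lia.
by move: up up0 ar cEE; move: (_ * (_ %/ 2)); clear; lia.
Qed.

Lemma meeting_away (V : finType) (E : {set {set V}}) (e e' : {set V}) :
  meeting (away E e) e' = meeting E e' :\: meeting E e.
Proof.
apply/setP => f; rewrite !inE; case: (f \in E); rewrite ?andbF //= negbK andbC.
by rewrite andbC.
Qed.

(** [e'] meets [(|W| - 2) / 2] edges of [E], of which [(|W| - 6) / 2] avoid [e]. *)
Lemma extremal4_pair (V : finType) (E M : {set {set V}}) (W e e' : {set V}) :
  extremal4 E M W -> e \in M -> e' \in M -> e' != e ->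
  #|meeting E e' :&: meeting E e| = 2.
Proof.
move=> ex eM e'M nee; have [_ ex0] := extremal4_split ex eM.
have M1 : 1 < #|M| by apply/card_gt1P; exists e, e'; rewrite eq_sym.
have e'0 : e' \in M :\ e by rewrite in_setD1 nee.
have [c0 _] := extremal4_split (ex0 M1) e'0.
have [c1 _] := extremal4_split ex e'M.
have [un fr EW [/subsetP ME _ _] _] := ex; have eE := ME e eM.
have cW0 : #|W :\: e| + 4 = #|W|.
  by move: (cardsID e W); rewrite (setIidPr (EW e eE)) (un e eE); clear; lia.
move: c0 c1 (cardsID (meeting E e) (meeting E e')); rewrite meeting_away.
by move: cW0; clear; lia.
Qed.

(** If [e], [B] were a diamond, [B] would have one vertex outside [e] and so miss some other
    matching edge [e']. The two edges meeting both [e] and [e'] have one vertex each in [e], so two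
    vertices of [e] are not joined to [e'], and then [e'] meets too few edges. *)
Lemma extremal4_light (V : finType) (E M : {set {set V}}) (W e B : {set V}) :
  extremal4 E M W -> 2 < #|M| -> e \in M -> B \in E -> #|B :&: e| != 3.
Proof.
move=> ex M3 eM BE; apply/eqP => Be.
have [un fr EW [ME tM _] _] := ex; have eE := subsetP ME e eM.
have [e' e'M [nee dB]] : exists2 e', e' \in M & e' != e /\ [disjoint B & e'].
  have : 1 < #|M :\ e| by rewrite card_setD1_matching //; move: M3; clear; lia.
  case/card_gt1P => e1 [e2 []]; rewrite !in_setD1 => /andP[n1 e1M] /andP[n2 e2M] n12.
  have [d1|/card_meet_gt0[x xB x1]] := boolP [disjoint B & e1].
    by exists e1.
  have [d2|/card_meet_gt0[y yB y2]] := boolP [disjoint B & e2].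
    by exists e2.
  have : #|B :\: e| = 1 by move: (cardsID e B); rewrite Be (un B BE); clear; lia.
  move/eqP/cards1P => [u hu].
  have d1 := trivIset_disjoint tM e1M eM n1; have d2 := trivIset_disjoint tM e2M eM n2.
  have : x \in B :\: e by rewrite inE xB (disjointFr d1 x1).
  have : y \in B :\: e by rewrite inE yB (disjointFr d2 y2).
  rewrite hu !inE => /eqP yu /eqP xu; move: y2; rewrite yu -xu.
  by rewrite (disjointFr (trivIset_disjoint tM e1M e2M n12) x1).
have e'E := subsetP ME e' e'M.
have dee := trivIset_disjoint tM e'M eM nee.
have [cX _] := extremal4_split ex e'M.
have small f : f \in meeting E e' -> f \in meeting E e -> #|f :&: e| <= 1.
  move=> fX' fX; have [fE _] := meetingP _ _ _ fX.
  have fe : f != e.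
    by apply: contraTneq fX' => ->; rewrite inE disjoint_sym dee andbF.
  have fB : f != B by apply: contraTneq fX' => ->; rewrite inE dB andbF.
  have := diamond_meet un fr eE BE fE _ fe fB; rewrite setIC => /(_ Be).
  by apply: leq_trans; apply: subset_leq_card; rewrite setIS // subsetUl.
have /eqP/cards2P[f [g [_ fg]]] := extremal4_pair ex eM e'M nee.
have [fX' fX] : f \in meeting E e' /\ f \in meeting E e.
  by apply/andP; rewrite -in_setI fg !inE eqxx.
have [gX' gX] : g \in meeting E e' /\ g \in meeting E e.
  by apply/andP; rewrite -in_setI fg !inE eqxx orbT.
have sub : e :&: outer E e' \subset (f :&: e) :|: (g :&: e).
  apply/subsetP => x; rewrite in_setI => /andP[xe /outerP[_ [h [hX' _ xh]]]].
  have [hE _] := meetingP _ _ _ hX'.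
  have : h \in meeting E e' :&: meeting E e.
    by rewrite in_setI hX'; apply/meetingP; split=> //; exists x.
  by rewrite fg !inE => /orP[]/eqP<-; rewrite xh xe ?orbT.
have c2 : #|e :&: outer E e'| <= 2.
  apply: leq_trans (subset_leq_card sub) _; rewrite cardsU.
  by apply: leq_trans (leq_subr _ _) _; apply: (@leq_add _ _ 1 1); apply: small.
have cW' : #|W :\: e'| + 4 = #|W|.
  by move: (cardsID e' W); rewrite (setIidPr (EW e' e'E)) (un e' e'E); clear; lia.
have c5 : #|outer E e'| + #|e :\: outer E e'| <= #|W :\: e'|.
  rewrite -card_disjoint_setU ?disjoint_setD //; apply: subset_leq_card.
  rewrite subUset (outer_sub e' EW); apply: subset_trans (subsetDl _ _) _.
  by rewrite subsetD EW // disjoint_sym.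
move: (meeting_card un fr e'E) c2 c5 cX cW' (cardsID (outer E e') e).
by rewrite (un e eE); clear; lia.
Qed.

(** Since [e] is in no diamond, meeting [(|W| - 2) / 2] edges takes all [|W| - 4] outer vertices. *)
Lemma extremal4_cover (V : finType) (E M : {set {set V}}) (W e : {set V}) :
  extremal4 E M W -> 2 < #|M| -> e \in M -> outer E e = W :\: e.
Proof.
move=> ex M3 eM; have [un fr EW [ME tM _] _] := ex; have eE := subsetP ME e eM.
have [cX _] := extremal4_split ex eM.
apply/eqP; rewrite eqEcard outer_sub //=.
move: (meeting_card_light un fr eE (fun f => extremal4_light ex M3 eM (B := f))) cX.
move: (cardsID e W); rewrite (setIidPr (EW e eE)) (un e eE).
by clear; lia.
Qed.

Lemma extremal4_trace_le2 (V : finType) (E M : {set {set V}}) (W e f : {set V}) :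
  extremal4 E M W -> 2 < #|M| -> e \in M -> f \in E -> f != e -> #|f :&: e| <= 2.
Proof.
move=> ex M3 eM fE fe; have [un fr EW [ME tM _] _] := ex; have eE := subsetP ME e eM.
by move: (card_trace_le3 un eE fE fe) (extremal4_light ex M3 eM fE); clear; lia.
Qed.

(** Each vertex of [e] is joined to [e'] and conversely, so the two common edges cover both. As each
    has at most two vertices in either, it has exactly two in both. *)
Lemma extremal4_cross (V : finType) (E M : {set {set V}}) (W e e' : {set V}) :
  extremal4 E M W -> 2 < #|M| -> e \in M -> e' \in M -> e' != e ->
  (forall f, f \in meeting E e -> f \in meeting E e' ->
     #|f :&: e| = 2 /\ f \subset e :|: e') /\
  (forall x, x \in e -> exists f,
     [/\ f \in meeting E e, f \in meeting E e' & x \in f]).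
Proof.
move=> ex M3 eM e'M nee.
have [un fr EW [ME tM _] _] := ex; have eE := subsetP ME e eM.
have e'E := subsetP ME e' e'M; have dee := trivIset_disjoint tM e'M eM nee.
have /eqP/cards2P[f [g [_ fg]]] := extremal4_pair ex eM e'M nee.
have fgP h : h \in meeting E e' :&: meeting E e -> h \in E /\
    (#|h :&: e| <= 2 /\ #|h :&: e'| <= 2).
  rewrite in_setI => /andP[hX' hX]; have [hE _] := meetingP _ _ _ hX.
  split=> //; split; apply: (extremal4_trace_le2 ex) => //.
    by apply: contraTneq hX' => ->; rewrite inE disjoint_sym dee andbF.
  by apply: contraTneq hX => ->; rewrite inE dee andbF.
have [fE [f1 f2]] : f \in E /\ (#|f :&: e| <= 2 /\ #|f :&: e'| <= 2).
  by apply: fgP; rewrite fg !inE eqxx.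
have [gE [g1 g2]] : g \in E /\ (#|g :&: e| <= 2 /\ #|g :&: e'| <= 2).
  by apply: fgP; rewrite fg !inE eqxx orbT.
have cov x : x \in e -> (x \in f) || (x \in g).
  move=> xe; have : x \in outer E e'.
    by rewrite (extremal4_cover ex) // inE (disjointFl dee) // (subsetP (EW e eE)).
  case/outerP=> xe' [h [hX' _ xh]]; have [hE _] := meetingP _ _ _ hX'.
  have : h \in meeting E e' :&: meeting E e.
    by rewrite in_setI hX'; apply/meetingP; split=> //; exists x.
  by rewrite fg !inE => /orP[]/eqP<-; rewrite xh ?orbT.
have cov' x : x \in e' -> (x \in f) || (x \in g).
  move=> xe; have : x \in outer E e.
    by rewrite (extremal4_cover ex) // inE (disjointFr dee) // (subsetP (EW e' e'E)).
  case/outerP=> xe' [h [hX _ xh]]; have [hE _] := meetingP _ _ _ hX.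
  have : h \in meeting E e' :&: meeting E e.
    by rewrite in_setI hX andbT; apply/meetingP; split=> //; exists x.
  by rewrite fg !inE => /orP[]/eqP<-; rewrite xh ?orbT.
have size4 (d : {set V}) : #|d| = 4 -> (forall x, x \in d -> (x \in f) || (x \in g)) ->
    4 <= #|f :&: d| + #|g :&: d|.
  move=> cd cv; rewrite -cardsUI -cd; apply: leq_trans (leq_addr _ _).
  apply: subset_leq_card; apply/subsetP => x xd; rewrite !inE xd !andbT.
  exact: cv.
have s1 := size4 e (un e eE) cov; have s2 := size4 e' (un e' e'E) cov'.
have inU h : h \in E -> #|h :&: e| = 2 -> #|h :&: e'| = 2 -> h \subset e :|: e'.
  move=> hE h1 h2; apply/setIidPl/eqP; rewrite eqEcard subsetIl setIUr.
  rewrite card_disjoint_setU ?h1 ?h2 ?(un h hE) //.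
  rewrite disjoint_subset; apply/subsetP => x; rewrite !inE => /andP[-> xe] /=.
  by rewrite (disjointFl dee xe).
split=> [h hX hX'|x xe]; last first.
  have /orP[xf|xg] := cov x xe.
    exists f; have : f \in meeting E e' :&: meeting E e by rewrite fg !inE eqxx.
    by rewrite in_setI => /andP[].
  exists g; have : g \in meeting E e' :&: meeting E e by rewrite fg !inE eqxx orbT.
  by rewrite in_setI => /andP[].
have : h \in meeting E e' :&: meeting E e by rewrite in_setI hX' hX.
have c1 : #|f :&: e| = 2 by move: s1 f1 g1; clear; lia.
have c2 : #|f :&: e'| = 2 by move: s2 f2 g2; clear; lia.
have c3 : #|g :&: e| = 2 by move: s1 f1 g1; clear; lia.
have c4 : #|g :&: e'| = 2 by move: s2 f2 g2; clear; lia.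
by rewrite fg in_set2 => /orP[]/eqP->; split=> //; apply: inU.
Qed.

(** Suppose [f] meets [e] only in [a] and no other matching edge. Exchanging [e] for [f] gives
    another maximum matching, so some [h] through [a] meets [e'] and has two vertices in [f]. But
    [h] also meets [e], hence lies in [e :|: e'], which contains only [a] from [f]. *)
Lemma extremal4_side (V : finType) (E M : {set {set V}}) (W e f : {set V}) :
  extremal4 E M W -> 2 < #|M| -> e \in M -> f \in meeting E e -> f != e ->
  #|f :&: e| = 2.
Proof.
move=> ex M3 eM fX fe; have [un fr EW mM cE] := ex; have [ME tM maxM] := mM.
have [fE [a af ae]] := meetingP _ _ _ fX; have eE := subsetP ME e eM.
have [/existsP[e' /and3P[e'M nee fX']]|none] :=
  boolP [exists e' : {set V}, [&& e' \in M, e' != e & f \in meeting E e']].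
  by have [h _] := extremal4_cross ex M3 eM e'M nee; case: (h f fX fX').
have dis e' : e' \in M -> e' != e -> [disjoint f & e'].
  move=> e'M nee; apply: contraNT none => nd; apply/existsP; exists e'.
  by rewrite e'M nee inE fE nd.
apply/eqP; rewrite eqn_leq (extremal4_trace_le2 ex) // ltnNge; apply/negP => c1.
have fM : f \notin M.
  apply/negP => fM; have := trivIset_disjoint tM fM eM fe.
  by move=> /disjointFr /(_ af); rewrite ae.
have cM' : #|f |: (M :\ e)| = #|M|.
  by rewrite cardsU1 in_setD1 (negPf fM) andbF (cardsD1 e M) eM.
have ex' : extremal4 E (f |: (M :\ e)) W.
  split; rewrite ?cM' //; split; rewrite ?cM' //.
    by rewrite subUset sub1set fE (subset_trans (subsetDl _ _) ME).
  apply/trivIsetP => g h; rewrite !inE => /orP[/eqP->|/andP[ge gM]].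
    by move=> /orP[/eqP->|/andP[he hM] _]; [rewrite eqxx | apply: dis].
  move=> /orP[/eqP->|/andP[he hM]]; first by rewrite disjoint_sym dis.
  exact: (trivIsetP tM).
have [e' e'M nee] := @exists_neq _ M e (ltnW M3).
have fM' : f \in f |: (M :\ e) by rewrite !inE eqxx.
have e'M' : e' \in f |: (M :\ e) by rewrite !inE nee e'M orbT.
have e'f : e' != f by apply: contraNneq fM => <-.
have M3' : 2 < #|f |: (M :\ e)| by rewrite cM'.
have [h1 h2] := extremal4_cross ex' M3' fM' e'M' e'f.
have [h [hf he' ah]] := h2 a af.
have [hE _] := meetingP _ _ _ hf; have [cf _] := h1 h hf he'.
have heX : h \in meeting E e by apply/meetingP; split=> //; exists a.
have [k1 _] := extremal4_cross ex M3 eM e'M nee.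
have [_ /subsetP sub] := k1 h heX he'.
have [y] : exists2 y, y \in h :&: f & y != a by apply: exists_neq; rewrite cf.
rewrite inE => /andP[yh yf] ya; have := sub y yh; rewrite inE => /orP[ye|ye'].
  move: c1; rewrite leqNgt => /negP; apply; apply/card_gt1P; exists a, y.
  by rewrite !inE af ae yf ye eq_sym.
by rewrite (disjointFr (dis e' e'M nee) yf) in ye'.
Qed.

(** By [extremal4_cross], an edge meeting two matching edges has no uncovered vertex. *)
Lemma extremal4_outside (V : finType) (E M : {set {set V}}) (W e f : {set V}) u :
  extremal4 E M W -> 2 < #|M| -> e \in M -> f \in meeting E e ->
  u \in f -> u \notin cover M ->
  #|f :&: e| = 2 /\ (forall e', e' \in M -> e' != e -> [disjoint f & e']).
Proof.
move=> ex M3 eM fX uf uM; have [fE _] := meetingP _ _ _ fX.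
have out e' : e' \in M -> u \notin e'.
  by move=> e'M; apply: contra uM => ue; apply/bigcupP; exists e'.
have fe : f != e by apply: contraTneq uf => ->; apply: out.
split; first exact: (extremal4_side ex).
move=> e' e'M nee; apply: contraT => nd.
have fX' : f \in meeting E e' by rewrite inE fE nd.
have [h _] := extremal4_cross ex M3 eM e'M nee; have [_ /subsetP /(_ u uf)] := h f fX fX'.
by rewrite inE (negPf (out e eM)) (negPf (out e' e'M)).
Qed.

(** If the traces differ, they are disjoint by [trace_share], and so are [f] and [g]; replacing [e]
    by both would enlarge the matching. *)
Lemma extremal4_same_side (V : finType) (E M : {set {set V}}) (W e f g : {set V}) u v :
  extremal4 E M W -> 2 < #|M| -> e \in M -> f \in meeting E e -> g \in meeting E e ->
  u \in f -> u \notin cover M -> v \in g -> v \notin cover M ->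
  f :&: e = g :&: e.
Proof.
move=> ex M3 eM fX gX uf uM vg vM.
have [un fr EW [ME tM maxM] _] := ex; have eE := subsetP ME e eM.
have [cf df] := extremal4_outside ex M3 eM fX uf uM.
have [cg dg] := extremal4_outside ex M3 eM gX vg vM.
have [fE [x xf xe]] := meetingP _ _ _ fX; have [gE _] := meetingP _ _ _ gX.
have out e' w : e' \in M -> w \notin cover M -> w \notin e'.
  by move=> e'M; apply: contra => we; apply/bigcupP; exists e'.
have fe : f != e by apply: contraTneq uf => ->; apply: out.
have ge : g != e by apply: contraTneq vg => ->; apply: out.
apply/eqP/negPn/negP => nfg.
have dfg : [disjoint f & g].
  rewrite disjoint_subset; apply/subsetP => p pf; rewrite inE; apply/negP => pg.
  have [pe|pe] := boolP (p \in e).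
    by move: nfg; rewrite (trace_share fr eE fE gE fe ge cf cg pf pg pe) eqxx.
  have gf : g = f by apply: (@trace2_unique _ E e f g p); rewrite ?cf.
  by rewrite gf eqxx in nfg.
have inM h : h \in meeting E e -> h != e -> h \notin M.
  move=> /meetingP[_ [y yh ye]] he; apply/negP => hM.
  by have := trivIset_disjoint tM hM eM he => /disjointFr /(_ yh); rewrite ye.
have : #|f |: (g |: (M :\ e))| <= #|M|.
  apply: maxM.
    by rewrite !subUset !sub1set fE gE (subset_trans (subsetDl _ _) ME).
  apply/trivIsetP => a b; rewrite !inE.
  case/or3P => [/eqP->|/eqP->|/andP[ae aM]] /or3P[/eqP->|/eqP->|/andP[be bM]] //.
  - by rewrite eqxx.
  - by move=> _; apply: df.
  - by rewrite disjoint_sym.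
  - by rewrite eqxx.
  - by move=> _; apply: dg.
  - by move=> _; rewrite disjoint_sym df.
  - by move=> _; rewrite disjoint_sym dg.
  - exact: (trivIsetP tM).
have nfg' : f != g by apply: contraNneq nfg => ->.
rewrite cardsU1 cardsU1 !inE (negPf nfg') (negPf (inM f fX fe)) (negPf (inM g gX ge)).
by rewrite !andbF card_setD1_matching //; move: M3; clear; lia.
Qed.

Lemma card2_compl (T : finType) (e p q : {set T}) :
  #|e| = 4 -> p \subset e -> q \subset e -> #|p| = 2 -> #|q| = 2 -> [disjoint p & q] ->
  q = e :\: p.
Proof.
move=> ce pe qe cp cq d; apply/eqP; rewrite eqEcard subsetD qe disjoint_sym d /=.
by rewrite cardsD (setIidPr pe) ce cp cq.
Qed.

Lemma setU_setDK (T : finType) (e p : {set T}) : p \subset e -> p :|: (e :\: p) = e.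
Proof. by move=> pe; rewrite setDE setUIr setUCr setIT; apply/setUidPr. Qed.

Lemma split_trace (T : finType) (f e e' : {set T}) :
  f \subset e :|: e' -> f = (f :&: e) :|: (f :&: e').
Proof. by move=> s; rewrite -setIUr (setIidPl s). Qed.

Lemma trace_union (T : finType) (e e' q p : {set T}) :
  q \subset e -> p \subset e' -> [disjoint e & e'] ->
  (q :|: p) :&: e' = p /\ (q :|: p) :&: e = q.
Proof.
move=> qe pe d; rewrite !setIUl (setIidPl qe) (setIidPl pe).
rewrite (disjoint_setI0 (disjointWl qe d)) set0U; split=> //.
rewrite (disjoint_setI0 (A := p)) ?setU0 //.
by apply: disjointWl pe _; rewrite disjoint_sym.
Qed.

(** Every matching edge splits into a half [p e] on the [P] side and a half [e :\: p e] on the [Y]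
    side, the choice being propagated from one edge [e1]. The remaining [Y] blocks are pairs of
    uncovered vertices. Once all unions of a [P] block and a [Y] block are known to be edges,
    counting shows that there are no others. *)
Lemma extremal4_bigrid (V : finType) (E M : {set {set V}}) :
  extremal4 E M setT -> 2 < #|M| ->
  exists m, exists P : 'I_#|M| -> {set V}, exists Y : 'I_m -> {set V},
  [/\ m = (#|V| - 2 * #|M|) %/ 2, blocks 2 P Y,
      forall x, exists k, x \in join_fam P Y k & E = bigrid P Y].
Proof.
move=> ex M3; have [un fr _ [ME tM maxM] [ev cE]] := ex.
have inE4 e : e \in M -> e \in E by apply: (subsetP ME).
have dM := trivIset_disjoint tM.
have [e1 e1M] : exists e : {set V}, e \in M.
  by apply/set0Pn; rewrite -card_gt0; apply: leq_trans M3.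
have [e2 e2M n21] := @exists_neq _ M e1 (ltnW M3).
have outM e w : e \in M -> w \notin cover M -> w \notin e.
  by move=> eM; apply: contra => we; apply/bigcupP; exists e.
have covU e u : e \in M -> u \notin cover M ->
    exists f, [/\ f \in meeting E e, f != e & u \in f].
  move=> eM uM; have : u \in outer E e.
    by rewrite (extremal4_cover ex) // !inE (outM e).
  by case/outerP.
(* [f1 :&: e1] will be the half of [e1] lying on the side of the [s] pairs. *)
have [f1 [f1X nf1 f1U]] : exists f1, [/\ f1 \in meeting E e1, f1 != e1 &
    forall u f, f \in meeting E e1 -> u \in f -> u \notin cover M -> f :&: e1 = f1 :&: e1].
  have [/existsP[u uM]|none] := boolP [exists u, u \notin cover M].
    have [f1 [f1X nf1 uf1]] := covU e1 u e1M uM; exists f1; split=> // v f fX vf vM.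
    exact: (extremal4_same_side ex M3 e1M fX f1X vf vM uf1 uM).
  have [_ h] := extremal4_cross ex M3 e1M e2M n21.
  have /card_gt0P[x xe1] : 0 < #|e1| by rewrite un // inE4.
  have [f [fX fX' _]] := h x xe1; exists f; split=> //.
    apply: contraTneq fX' => ->; rewrite inE negb_and negbK dM ?orbT //.
    by rewrite eq_sym.
  by move=> u g _ _ uM; case/negP: none; apply/existsP; exists u.
have cp1 := extremal4_side ex M3 e1M f1X nf1.
set p1 := f1 :&: e1 in cp1 f1U.
have p1e : p1 \subset e1 by apply: subsetIr.
have [f1E _] := meetingP _ _ _ f1X.
have e1E := inE4 _ e1M.
have tr e f g x : e \in M -> f \in meeting E e -> g \in meeting E e -> f != e -> g != e ->
    x \in f -> x \in g -> x \in e -> f :&: e = g :&: e.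
  move=> eM fX gX fe ge; have [fE _] := meetingP _ _ _ fX.
  have [gE _] := meetingP _ _ _ gX.
  by apply: (trace_share fr) => //; rewrite ?inE4 ?(extremal4_side ex).
have cq1 : #|e1 :\: p1| = 2 by rewrite cardsD (setIidPr p1e) cp1 (un _ e1E).
(* Of the two edges meeting both [e1] and [e], the one through [e1 :\: p1] cuts out [p e], and the
   one through [p1] the other half of [e]. *)
have pex e : exists p : {set V}, e \in M -> [/\ #|p| = 2, p \subset e,
    (e1 :\: p1) :|: p \in E, p1 :|: (e :\: p) \in E & e = e1 -> p = p1].
  have [eM|//] := boolP (e \in M); last by exists set0.
  have [->|n1] := eqVneq e e1.
    exists p1 => _; split=> //.
      by rewrite setUC (setU_setDK p1e).
    by rewrite (setU_setDK p1e).
  have eE := inE4 _ eM; have d1 : [disjoint e1 & e] by apply: dM; rewrite // eq_sym.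
  have [h1 h2] := extremal4_cross ex M3 e1M eM n1.
  have n1' : e1 != e by rewrite eq_sym.
  have [k1 _] := extremal4_cross ex M3 eM e1M n1'.
  have ntr f : f \in meeting E e -> f != e1.
    by apply: contraTneq => ->; rewrite inE d1 andbF.
  have ntr' f : f \in meeting E e1 -> f != e.
    by apply: contraTneq => ->; rewrite inE disjoint_sym d1 andbF.
  have /card_gt0P[x xq] : 0 < #|e1 :\: p1| by rewrite cq1.
  have /card_gt0P[y yp] : 0 < #|p1| by rewrite cp1.
  move: (xq); rewrite inE => /andP[xp xe].
  have ye := subsetP p1e y yp; have yf1 : y \in f1 by move: yp; rewrite inE => /andP[].
  have [h [hX hX' xh]] := h2 x xe; have [ch sh] := h1 h hX hX'.
  have [h' [h'X h'X' yh]] := h2 y ye; have [ch' sh'] := h1 h' h'X h'X'.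
  have [hE _] := meetingP _ _ _ hX; have [h'E _] := meetingP _ _ _ h'X.
  have th' : h' :&: e1 = p1 by apply: (tr e1 h' f1 y) => //; apply: ntr.
  have th : h :&: e1 = e1 :\: p1.
    apply: card2_compl; rewrite ?(un _ e1E) ?subsetIr //.
    rewrite disjoint_subset; apply/subsetP => z zp; rewrite !inE negb_and.
    apply/orP; left; apply/negP => zh.
    have ze := subsetP p1e z zp; have zf : z \in f1 by move: zp; rewrite inE => /andP[].
    have tt := tr e1 h f1 z e1M hX f1X (ntr _ hX') nf1 zh zf ze.
    have : x \in h :&: e1 by rewrite inE xh.
    by rewrite tt (negPf xp).
  have [chp _] := k1 h hX' hX; have [chp' _] := k1 h' h'X' h'X.
  have neq : h != h'.
    apply: contraNneq xp => hh; have : x \in h' :&: e1 by rewrite inE -hh xh.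
    by rewrite th'.
  exists (h :&: e) => _; split; rewrite ?subsetIr //.
  - by rewrite -th -split_trace.
  - have <- : h' :&: e = e :\: (h :&: e).
      apply: card2_compl; rewrite ?(un _ eE) ?subsetIr //.
      rewrite disjoint_subset; apply/subsetP => z; rewrite !inE => /andP[zh ze].
      rewrite negb_and; apply/orP; left; apply/negP => zh'.
      have zn1 : z \notin e1 by rewrite (disjointFl d1).
      have hh : h = h'.
        by apply: (@trace2_unique _ E e1 h' h z) => //; rewrite ?ch' // ntr.
      by rewrite hh eqxx in neq.
    by rewrite -th' -split_trace.
  by move=> ee; rewrite ee eqxx in n1.
have [p pP] := fin_all_exists pex.
have cp e : e \in M -> #|p e| = 2 by move=> /pP[].
have pe e : e \in M -> p e \subset e by move=> /pP[].
have qp e : e \in M -> (e1 :\: p1) :|: p e \in E by move=> /pP[].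
have pq e : e \in M -> p1 :|: (e :\: p e) \in E by move=> /pP[].
have pe1 : p e1 = p1 by have [_ _ _ _] := pP _ e1M; apply.
have cq e : e \in M -> #|e :\: p e| = 2.
  by move=> eM; rewrite cardsD (setIidPr (pe e eM)) cp // un // inE4.
have mX (e f : {set V}) x : f \in E -> x \in f -> x \in e -> f \in meeting E e.
  by move=> fE xf xe; apply/meetingP; split=> //; exists x.
have qpe e : e \in M -> e != e1 -> [/\ (e1 :\: p1) :|: p e \in meeting E e,
    (e1 :\: p1) :|: p e != e & ((e1 :\: p1) :|: p e) :&: e = p e].
  move=> eM n1; have d1 : [disjoint e1 & e] by apply: dM; rewrite // eq_sym.
  have [tq tq'] := trace_union (subsetDl e1 p1) (pe e eM) d1.
  split=> //.
    have /card_gt0P[x xp] : 0 < #|p e| by rewrite cp.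
    by apply: (mX _ _ x); rewrite ?qp ?(subsetP (pe e eM)) // inE xp orbT.
  by apply/eqP => eq; move: (cp e eM); rewrite -tq eq setIid un // inE4.
(* An edge [h] through a vertex of [p e] that meets [e'] has trace [p e] on [e]. If it met [p e'],
   it would form a triangle with [(e1 :\: p1) :|: p e] and [(e1 :\: p1) :|: p e']. *)
have core e e' : e \in M -> e' \in M -> p e :|: (e' :\: p e') \in E.
  move=> eM e'M; have [->|nee] := eqVneq e e'.
    by rewrite (setU_setDK (pe e' e'M)) inE4.
  have [->|n1] := eqVneq e e1; first by rewrite pe1 pq.
  have [->|n1'] := eqVneq e' e1; first by rewrite pe1 setUC qp.
  have dee := dM _ _ eM e'M nee; have eE := inE4 _ eM; have e'E := inE4 _ e'M.
  have [gX ge gt] := qpe e eM n1; have [g'X g'e gt'] := qpe e' e'M n1'.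
  rewrite eq_sym in nee; have [h1 h2] := extremal4_cross ex M3 eM e'M nee.
  have /card_gt0P[x xp] : 0 < #|p e| by rewrite cp.
  have xe := subsetP (pe e eM) x xp.
  have [h [hX hX' xh]] := h2 x xe; have [ch sh] := h1 h hX hX'.
  have [hE _] := meetingP _ _ _ hX.
  have he : h != e by apply: contraTneq hX' => ->; rewrite inE dee andbF.
  have he' : h != e' by apply: contraTneq hX => ->; rewrite inE disjoint_sym dee andbF.
  have xg : x \in (e1 :\: p1) :|: p e by rewrite inE xp orbT.
  have th : h :&: e = p e by rewrite -gt; apply: (tr e h _ x).
  have <- : h :&: e' = e' :\: p e'.
    have ch' := extremal4_side ex M3 e'M hX' he'.
    apply: card2_compl; rewrite ?(un _ e'E) ?subsetIr ?cp ?pe //.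
    rewrite disjoint_subset; apply/subsetP => y yp; rewrite !inE negb_and.
    apply/orP; left; apply/negP => yh.
    have /card_gt0P[z zq] : 0 < #|e1 :\: p1| by rewrite cq1.
    have ze1 : z \in e1 by move: zq; rewrite inE => /andP[].
    have ye' := subsetP (pe e' e'M) y yp.
    have d1 := dM _ _ e1M eM; have d1' := dM _ _ e1M e'M.
    rewrite eq_sym in n1; rewrite eq_sym in n1'.
    have zh : z \notin h.
      apply/negP => /(subsetP sh); rewrite inE (disjointFr (d1 n1) ze1).
      by rewrite (disjointFr (d1' n1') ze1).
    have yne : y \notin e by rewrite (disjointFl dee).
    have xne : x \notin e' by rewrite (disjointFr dee).
    apply: (@triangle_absurd _ E ((e1 :\: p1) :|: p e) h ((e1 :\: p1) :|: p e') z x y) => //.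
    + exact: qp.
    + exact: qp.
    + by apply: contraNneq zh => <-; rewrite inE zq.
    + by apply: contraNneq zh => ->; rewrite inE zq.
    + apply/eqP => gg; move: xg; rewrite gg inE => /orP[|xp'].
        by rewrite inE => /andP[_]; rewrite (disjointFl (d1 n1) xe).
      by rewrite (subsetP (pe e' e'M)) in xne.
    + by apply: contraNneq zh => ->.
    + by apply: contraNneq xne => ->.
    + by apply: contraNneq zh => ->.
    + by rewrite inE zq.
    + by rewrite inE zq.
    + by rewrite inE yp orbT.
  by rewrite -th -split_trace.
have fU u : u \notin cover M -> exists f, [/\ f \in meeting E e1, u \in f,
    f = p1 :|: (f :\: e1), #|f :\: e1| = 2 &
    forall e, e \in M -> [disjoint f :\: e1 & e]].
  move=> uM; have [f [fX nf uf]] := covU e1 u e1M uM; have [fE _] := meetingP _ _ _ fX.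
  have [cf df] := extremal4_outside ex M3 e1M fX uf uM.
  have tf := f1U u f fX uf uM.
  exists f; split=> //; first by rewrite -tf setID.
    by move: (cardsID e1 f); rewrite cf (un f fE); clear; lia.
  move=> e eM; have [->|ne] := eqVneq e e1.
    by rewrite disjoint_sym disjoint_setD.
  by apply: disjointWl (df e eM ne); apply: subsetDl.
(* If [f] met [e] in the wrong half, it would form a triangle with [p1 :|: (e :\: p e)] and an edge
   [g] joining [u] to [p1]. *)
have trU e u f : e \in M -> u \notin cover M -> f \in meeting E e -> u \in f ->
    f :&: e = p e.
  move=> eM uM fX uf; have [ee|n1] := eqVneq e e1.
    by rewrite ee in fX *; rewrite pe1; apply: (f1U u f).
  have [fE _] := meetingP _ _ _ fX; have eE := inE4 _ eM.
  have [cf df] := extremal4_outside ex M3 eM fX uf uM.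
  have fe : f != e by apply: contraTneq uf => ->; apply: outM.
  have [gX ge gt] := qpe e eM n1.
  have [/card_meet_gt0[x xf]|d] := boolP (~~ [disjoint f :&: e & p e]).
    move=> xp; move: xf; rewrite inE => /andP[xf xe].
    by rewrite -gt; apply: (tr e f _ x) => //; rewrite inE xp orbT.
  have tf : f :&: e = e :\: p e.
    apply: card2_compl; rewrite ?(un _ eE) ?subsetIr ?cp ?pe //.
    by rewrite disjoint_sym -[X in is_true X]negbK.
  have [g [gX1 ug eg _ dg]] := fU u uM.
  have /card_gt0P[x xp] : 0 < #|p1| by rewrite cp1.
  have /card_gt0P[y yq] : 0 < #|e :\: p e| by rewrite cq.
  have xe1 := subsetP p1e x xp.
  move: (yq); rewrite -tf inE => /andP[yf ye].
  have n1' : e1 != e by rewrite eq_sym.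
  have xne : x \notin e by rewrite (disjointFr (dM _ _ e1M eM n1') xe1).
  have [gE _] := meetingP _ _ _ gX1.
  have yg : y \notin g.
    rewrite eg inE negb_or (disjointFl (dg e eM) ye) andbT.
    apply/negP => /(subsetP p1e) y1; rewrite eq_sym in n1.
    by rewrite (disjointFr (dM _ _ e1M eM n1) y1) in ye.
  have uq : u \notin p1 :|: (e :\: p e).
    rewrite inE negb_or; apply/andP; split; apply/negP.
      by move=> /(subsetP p1e); apply/negP; apply: outM.
    by rewrite inE => /andP[_]; apply/negP; apply: outM.
  case: (@triangle_absurd _ E g f (p1 :|: (e :\: p e)) x u y) => //.
  - exact: pq.
  - by apply: contraNneq yg => ->.
  - by apply: contraNneq uq => <-.
  - by apply: contraNneq uq => <-.
  - by apply: contraTneq xe1 => ->; apply: outM.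
  - by apply: contraTneq ye => <-; apply: outM.
  - by apply: contraNneq xne => ->.
  - by rewrite eg inE xp.
  - by rewrite inE xp.
  - by rewrite inE yq orbT.
(* The edge [g] joining [u] to [e] has the same uncovered pair as [f]. If [w] in [f :\: e1] were not
   in [g], an edge [h] joining [w] to [e] would contain [p e] too, and [f], [h], [g] would form a
   triangle on [u], [w] and a vertex of [p e]. *)
have coreU e f u : e \in M -> u \notin cover M -> f \in meeting E e1 -> u \in f ->
    p e :|: (f :\: e1) \in E.
  move=> eM uM fX uf; have [fE _] := meetingP _ _ _ fX.
  have [->|n1] := eqVneq e e1.
    by rewrite pe1 -(f1U u f fX uf uM) setID.
  have [cf df] := extremal4_outside ex M3 e1M fX uf uM.
  have [g [gX ge ug]] := covU e u eM uM; have [gE _] := meetingP _ _ _ gX.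
  have [cg dg] := extremal4_outside ex M3 eM gX ug uM.
  have tg := trU e u g eM uM gX ug.
  suff <- : g :\: e = f :\: e1 by rewrite -tg setID.
  have cf2 : #|f :\: e1| = 2.
    by move: (cardsID e1 f); rewrite cf (un f fE); clear; lia.
  have cg2 : #|g :\: e| = 2.
    by move: (cardsID e g); rewrite cg (un g gE); clear; lia.
  apply/esym/eqP; rewrite eqEcard cg2 cf2 andbT; apply/subsetP => w.
  rewrite in_setD => /andP[we1 wf].
  have wM : w \notin cover M.
    apply/negP => /bigcupP[e' e'M we']; have [e'1|n] := eqVneq e' e1.
      by rewrite e'1 (negPf we1) in we'.
    by rewrite (disjointFr (df e' e'M n) wf) in we'.
  rewrite in_setD (outM e) //=; apply/negPn/negP => wg.
  have [h [hX he wh]] := covU e w eM wM; have [hE _] := meetingP _ _ _ hX.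
  have th := trU e w h eM wM hX wh.
  have /card_gt0P[x xp] : 0 < #|p e| by rewrite cp.
  have xe := subsetP (pe e eM) x xp.
  have xh : x \in h by move: xp; rewrite -th inE => /andP[].
  have xg : x \in g by move: xp; rewrite -tg inE => /andP[].
  have xf : x \notin f by rewrite (disjointFl (df e eM n1) xe).
  apply: (@triangle_absurd _ E f h g u w x) => //.
  - by apply: contraNneq xf => ->.
  - by apply: contraNneq wg => <-.
  - by apply: contraNneq xf => ->.
  - by apply: contraNneq wg => <-.
  - by apply: contraNneq xf => <-.
  - by apply: contraNneq xf => <-.
pose QY := [set e :\: p e | e : {set V} in M].
pose UY := [set f :\: e1 | f : {set V} in [set f in meeting E e1 | ~~ (f \subset cover M)]].
have UYP y : y \in UY -> exists f u, [/\ f \in meeting E e1, u \in f, u \notin cover M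
    & y = f :\: e1].
  case/imsetP => f; rewrite inE => /andP[fX /subsetPn[u uf uM]] ->.
  by exists f, u.
have UYdis y e : y \in UY -> e \in M -> [disjoint y & e].
  move=> /UYP[f [u [fX uf uM ->]]] eM.
  have [->|ne] := eqVneq e e1; first by rewrite disjoint_sym disjoint_setD.
  have [_ df] := extremal4_outside ex M3 e1M fX uf uM.
  by apply: disjointWl (df e eM ne); apply: subsetDl.
pose YY := QY :|: UY.
pose P (i : 'I_#|M|) := p (enum_val i).
pose Y (j : 'I_#|YY|) := enum_val j.
have PM (i : 'I_#|M|) : enum_val i \in M := enum_valP i.
have disYY y y' x : y \in YY -> y' \in YY -> x \in y -> x \in y' -> y = y'.
  rewrite !inE => /orP[/imsetP[e eM ->]|yU] /orP[/imsetP[e' e'M ->]|yU'].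
  - rewrite !inE => /andP[_ xe] /andP[_ xe'].
    have [->//|n] := eqVneq e e'.
    by rewrite (disjointFr (dM _ _ eM e'M n) xe) in xe'.
  - by rewrite inE => /andP[_ xe]; rewrite (disjointFl (UYdis _ _ yU' eM) xe).
  - by move=> xy; rewrite inE (disjointFr (UYdis _ _ yU e'M) xy) andbF.
  have [f [u [fX uf uM ->]]] := UYP _ yU; have [f' [u' [fX' uf' uM' ->]]] := UYP _ yU'.
  rewrite !inE => /andP[xe xf] /andP[_ xf']; congr (_ :\: _).
  have [fE _] := meetingP _ _ _ fX'; have [cf _] := extremal4_outside ex M3 e1M fX' uf' uM'.
  apply: (@trace2_unique _ E e1 f' f x); rewrite ?cf //.
  by apply: contraTneq uf' => ->; apply: outM.
have disPY e y x : e \in M -> y \in YY -> x \in p e -> x \notin y.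
  move=> eM; rewrite inE => /orP[/imsetP[e' e'M ->]|yU] xp.
    rewrite inE negb_and negbK; have [<-|n] := eqVneq e e'; first by rewrite xp.
    by rewrite (disjointFr (dM _ _ eM e'M n) (subsetP (pe e eM) x xp)) orbT.
  by rewrite (disjointFl (UYdis _ _ yU eM)) // (subsetP (pe e eM)).
have bl : blocks 2 P Y.
  split.
  - by move=> i; apply: cp; apply: PM.
  - move=> j; have := enum_valP j; rewrite -/(Y j) inE => /orP[/imsetP[e eM ->]|].
      exact: cq.
    move=> /UYP[f [u [fX uf uM ->]]]; have [fE _] := meetingP _ _ _ fX.
    have [cf _] := extremal4_outside ex M3 e1M fX uf uM.
    by move: (cardsID e1 f); rewrite cf (un f fE); clear; lia.
  case=> [i|i] [j|j] x /= xi xj.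
  - congr inl; apply/enum_val_inj/eqP/negPn/negP => n.
    have := disjointFr (dM _ _ (PM i) (PM j) n) (subsetP (pe _ (PM i)) x xi).
    by rewrite (subsetP (pe _ (PM j)) x xj).
  - by have := disPY _ _ x (PM i) (enum_valP j) xi; rewrite xj.
  - by have := disPY _ _ x (PM j) (enum_valP i) xj; rewrite xi.
  - by congr inr; apply: enum_val_inj; apply: disYY xi xj; apply: enum_valP.
have cov x : exists k, x \in join_fam P Y k.
  have inY y : y \in YY -> x \in y -> exists k, x \in join_fam P Y k.
    by move=> yY xy; exists (inr (enum_rank_in yY y)); rewrite /= /Y enum_rankK_in.
  have [/bigcupP[e eM xe]|xM] := boolP (x \in cover M).
    have [xp|xp] := boolP (x \in p e).
      by exists (inl (enum_rank_in eM e)); rewrite /= /P enum_rankK_in.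
    apply: (inY (e :\: p e)); last by rewrite inE xp.
    by rewrite inE; apply/orP; left; apply/imsetP; exists e.
  have [f [fX xf _ _ _]] := fU x xM; apply: (inY (f :\: e1)).
    rewrite inE; apply/orP; right; apply/imsetP; exists f => //.
    by rewrite inE fX; apply/subsetPn; exists x.
  by rewrite inE xf (outM e1).
have cm : #|YY| = (#|V| - 2 * #|M|) %/ 2.
  by rewrite (card_blocks bl cov) addnC addnK mulnC mulnK.
exists #|YY|, P, Y; split=> //.
have cG : #|bigrid P Y| = #|E|.
  by rewrite (card_bigrid _ bl) // cE cardsT; congr (_ * _).
apply/esym/eqP; rewrite eqEcard cG leqnn andbT.
apply/subsetP => g /bigridP[i [j ->]]; have := enum_valP j.
rewrite -/(Y j) [in X in X -> _]inE => /orP[/imsetP[e eM ->]|/UYP[f [u [fX uf uM ->]]]].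
  by apply: core; rewrite // PM.
exact: (coreU _ _ u).
Qed.

(** * The theorem *)

Lemma matching_number_attained (V : finType) (E : {set {set V}}) :
  exists2 M, max_matching E M & #|M| = matching_number E.
Proof.
pose Q := [pred M : {set {set V}} | (M \subset E) && trivIset M].
have Q0 : 0 < #|Q|.
  apply/card_gt0P; exists set0; rewrite inE sub0set.
  by apply/trivIsetP => A B; rewrite inE.
have [M MQ cM] := eq_bigmax_cond (fun M : {set {set V}} => #|M|) Q0.
have /andP[ME tM] : (M \subset E) && trivIset M := MQ.
exists M; last by rewrite -cM.
split=> // M' M'E tM'; rewrite -cM.
by apply: (@leq_bigmax_cond _ Q (fun M : {set {set V}} => #|M|)); rewrite inE M'E.
Qed.

Lemma H3_blocks s n : 2 * s <= n ->
  blocks 1 (fun i : 'I_s => segment n (2 * i) 2)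
           (fun j : 'I_(n - 2 * s) => segment n (2 * s + 1 * j) 1).
Proof. by move=> sn; apply: segment_blocks => //; lia. Qed.

Lemma H4_grid_blocks s n : 2 * s <= n ->
  blocks 2 (fun i : 'I_s => segment n (2 * i) 2)
           (fun j : 'I_((n - 2 * s) %/ 2) => segment n (2 * s + 2 * j) 2).
Proof. by move=> sn; apply: segment_blocks => //; lia. Qed.
(** The right side is [(n - 1) / 2] if [n] is 1 modulo 4, and [(n - 2) / 2] rounded down
    otherwise. *)
Lemma star_arith m n : 2 * m + 1 <= n -> (2 * m + 1 = n -> n %% 4 = 1) ->
  m <= 2 * ((n - 1) %/ 4) + (4 %| n).
Proof.
move=> up ex; have [d|d] := eqVneq (2 * m + 1) n; last lia.
by have := ex d; lia.
Qed.

Theorem theorem1p4 (r s n : nat) (hr : 3 <= r) (hs : 1 <= s)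
    (hr34 : r = 3 \/ r = 4)
    (V : finType) (hV : #|V| = n) (E : {set {set V}})
    (hE : uniform r E) (hfree : berge_triangle_free E)
    (hnu : matching_number E = s) :
  #|E| <= #|Hext r s n| /\
  (r = 3 \/ [/\ r = 4, ~~ odd n & 2 < s] ->
    [/\ uniform r (Hext r s n), berge_triangle_free (Hext r s n),
        matching_number (Hext r s n) = s
      & #|E| = #|Hext r s n| -> isomorphic E (Hext r s n)]).
Proof.
have [M mM cM] := matching_number_attained E; rewrite hnu in cM.
have [ME tM _] := mM.
have sn : r * s <= n.
  rewrite -hV -cM -cardsT; exact: (card_matching_le hE).
case: hr34 => er; subst r.
  rewrite /Hext /= H3_bigrid.
  have s2 : 2 * s <= n by move: sn; clear; lia.
  have b := H3_blocks s2; rewrite (card_bigrid _ b) //; split.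
    by rewrite -hV -cM; apply: upper3.
  move=> _; split.
  - exact: (bigrid_uniform b).
  - exact: (bigrid_btf _ b).
  - by apply: (bigrid_matching_number _ _ b) => //; move: sn; clear; lia.
  rewrite -hV -cM in b * => cE.
  have [m [P [Y [em bP cov ->]]]] := extremal3_bigrid hE hfree mM cE; subst m.
  by apply: (bigrid_isomorphic _ bP b cov); rewrite card_ord.
have un : uniform 4 E := hE.
have EW f : f \in E -> f \subset [set: V] by move=> _; apply: subsetT.
have n0 : 0 < n by move: sn hs; clear; lia.
have s2 : 2 * s <= n by move: sn; clear; lia.
have [s1|s1] := eqVneq s 1.
  (* With [r = 4], uniqueness is claimed for [2 < s] only, so here just the bound remains. *)
  split; last by case=> [//|[_ _]]; rewrite s1.
  rewrite /Hext /= s1 /= card_H4_star //.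
  have [|up ex] := upper4_star un hfree EW mM; first by rewrite cM.
  rewrite cardsT hV in up ex.
  exact: star_arith up ex.
rewrite /Hext /= (negPf s1) H4_grid_bigrid.
have b := H4_grid_blocks s2; rewrite (card_bigrid _ b) //; split.
  by rewrite -hV -cardsT; apply: (upper4 un hfree EW mM).
case=> [//|[_ ev s3]]; split.
- exact: (bigrid_uniform b).
- exact: (bigrid_btf _ b).
- by apply: (bigrid_matching_number _ _ b) => //; move: sn; clear; lia.
move=> cE; have ex : extremal4 E M setT by split=> //; rewrite cardsT hV cM.
have M3 : 2 < #|M| by rewrite cM.
have [m [P [Y [em bP cov ->]]]] := extremal4_bigrid ex M3.
clear - hV cM em bP cov b.
subst s n m; apply: (bigrid_isomorphic _ bP b cov).
by rewrite card_ord.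
Qed.
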